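(* A Banach lattice $E$ is reflexive if and only if $E$ has the unbounded Grothendieck property.
   Context: For a Banach lattice $E$ with dual $E'$, a sequence $(x_n')\subseteq E'$ is unbounded weak$^*$ convergent to $0$ (written $x_n'\xrightarrow{uaw^*}0$) if $|x_n'|\wedge u'\to 0$ in the weak$^*$ topology $\sigma(E',E)$ for every $u'\in E'_+$. $E$ has the unbounded Grothendieck property if every norm bounded sequence $(x_n')\subseteq E'$ with $x_n'\xrightarrow{uaw^*}0$ converges to $0$ weakly (in $\sigma(E',E'')$). *)

(* Defs.v *)
From HB Require Import structures.
From mathcomp Require Import all_boot all_order all_algebra.
From mathcomp Require Import all_classical all_reals all_analysis.
Set Implicit Arguments. Unset Strict Implicit. Unset Printing Implicit Defensive.
Import Order.TTheory GRing.Theory Num.Theory.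
Import numFieldNormedType.Exports.
Local Open Scope classical_set_scope.
Local Open Scope ring_scope.

Record banach_lattice (R : realType) (E : completeNormedModType R) := BanachLattice {
  ble : E -> E -> Prop;
  bjoin : E -> E -> E;
  ble_refl : forall x, ble x x;
  ble_anti : forall x y, ble x y -> ble y x -> x = y;
  ble_trans : forall x y z, ble x y -> ble y z -> ble x z;
  ble_add : forall x y z, ble x y -> ble (x + z) (y + z);
  ble_scale : forall (a : R) x y, 0 <= a -> ble x y -> ble (a *: x) (a *: y);
  bjoin_ubl : forall x y, ble x (bjoin x y);
  bjoin_ubr : forall x y, ble y (bjoin x y);
  bjoin_least : forall x y z, ble x z -> ble y z -> ble (bjoin x y) z;
  blattice_norm : forall x y, ble (bjoin x (- x)) (bjoin y (- y)) -> `|x| <= `|y|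
}.

Section Duality.
Variables (R : realType) (E : completeNormedModType R).

Definition in_dual (f : E -> R) : Prop :=
  (forall (a : R) (x y : E), f (a *: x + y) = a * f x + f y) /\ continuous f.

Definition dual_norm (f : E -> R) : R :=
  sup [set `|f x| | x in [set x : E | `|x| <= 1]].

(* Elements of the bidual E'' : bounded linear functionals on (E', dual_norm);
   only their values on elements of E' are relevant. *)
Definition in_bidual (phi : (E -> R) -> R) : Prop :=
  (forall (a : R) (f g : E -> R), in_dual f -> in_dual g ->
      phi (fun x => a * f x + g x) = a * phi f + phi g) /\
  exists C : R, forall f, in_dual f -> `|phi f| <= C * dual_norm f.

Definition reflexive_space : Prop :=
  forall phi, in_bidual phi -> exists x : E, forall f, in_dual f -> phi f = f x.

Definition dual_bounded (xs : nat -> E -> R) : Prop :=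
  exists C : R, forall n, dual_norm (xs n) <= C.

Definition dual_weak_null (xs : nat -> E -> R) : Prop :=
  forall phi, in_bidual phi -> phi (xs n) @[n --> \oo] --> (0 : R).

Variable L : banach_lattice E.

Definition dual_le (f g : E -> R) : Prop :=
  forall x, ble L 0 x -> f x <= g x.

Definition is_dual_sup (f g h : E -> R) : Prop :=
  [/\ in_dual h, dual_le f h, dual_le g h &
      forall k, in_dual k -> dual_le f k -> dual_le g k -> dual_le h k].

Definition is_dual_inf (f g h : E -> R) : Prop :=
  [/\ in_dual h, dual_le h f, dual_le h g &
      forall k, in_dual k -> dual_le k f -> dual_le k g -> dual_le k h].

(* x'_n --uaw*--> 0 : for every u' in E'_+, |x'_n| /\ u' -> 0 weak*,
   where |x'| = x' \/ (-x') is computed in the vector lattice E'. *)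
Definition uaws_null (xs : nat -> E -> R) : Prop :=
  forall u, in_dual u -> dual_le (fun _ => 0) u ->
  forall (a g : nat -> E -> R),
    (forall n, is_dual_sup (xs n) (fun x => - xs n x) (a n)) ->
    (forall n, is_dual_inf (a n) u (g n)) ->
    forall x : E, g n x @[n --> \oo] --> (0 : R).

Definition unbounded_grothendieck : Prop :=
  forall xs : nat -> E -> R,
    (forall n, in_dual (xs n)) -> dual_bounded xs -> uaws_null xs ->
    dual_weak_null xs.

End Duality.

(* Main.v *)
Require Import Defs.
From HB Require Import structures.
From mathcomp Require Import all_boot all_order all_algebra.
From mathcomp Require Import all_classical all_reals all_analysis.
From mathcomp Require Import ring lra.
Set Implicit Arguments. Unset Strict Implicit. Unset Printing Implicit Defensive.
Import Order.TTheory GRing.Theory Num.Theory.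
Import numFieldNormedType.Exports.
Local Open Scope classical_set_scope.
Local Open Scope ring_scope.

(* Call a positive functional [phi] on E' disjointly null if it tends to 0 along
   bounded disjoint positive sequences; a disjointification argument then yields, for
   every e, some u' in E'_+ with [phi ((f - u')^+) <= e] for all f >= 0 in the unit ball.

   If E is reflexive, every x >= 0 in E is disjointly null: by Mazur, a cluster point of
   a disjoint sequence is approximated by two convex combinations with disjoint
   supports, which are therefore both small at x. Splitting |x'_n| into |x'_n| /\ u' and
   (|x'_n| - u')^+ shows that uaw*-null bounded sequences are weak* null, hence weakly null.

   Conversely, bounded disjoint sequences of E', and decreasing sequences of E'_+ that
   tend to 0 pointwise, are always uaw*-null, so under the unbounded Grothendieck property
   they are weakly null. The first fact makes every phi in E''_+ disjointly null; the
   second makes functionals in [0, u'] that are small at a suitable x in E small in norm.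
   Together they give [phi = phi /\ t x + (small)]. An element psi of E'' with
   [0 <= psi <= x] is approximated by elements of the order interval [0, x]: among those
   close to psi on finitely many functionals, near-minimisers of the uniformly convex
   functional [y |-> u' (y^2 / x)] are close to one another in norm. Hence E is dense in
   E'', and it is closed since E is complete. *)

(** * Linear identities in modules *)

Section VectorExpressions.
Variables (K : comNzRingType) (V : lmodType K).

Inductive vexp :=
  | VVar of nat | VAdd of vexp & vexp | VOpp of vexp | VScale of K & vexp | VZero.

Fixpoint veval (env : seq V) e : V :=
  match e with
  | VVar i => nth 0 env i
  | VAdd a b => veval env a + veval env b
  | VOpp a => - veval env a
  | VScale k a => k *: veval env a
  | VZero => 0
  end.

Fixpoint vcoef (i : nat) e : K :=
  match e with
  | VVar j => if eqn j i then 1 else 0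
  | VAdd a b => vcoef i a + vcoef i b
  | VOpp a => - vcoef i a
  | VScale k a => k * vcoef i a
  | VZero => 0
  end.

Lemma vevalE env e :
  veval env e = \sum_(i < size env) vcoef i e *: nth 0 env i.
Proof.
elim: e => [j|a IHa b IHb|a IHa|k a IHa|] /=.
- have [ji|ij] := ltnP j (size env).
    rewrite (bigD1 (Ordinal ji)) //= eqnE eqxx scale1r big1 ?addr0 // => i ij.
    case: eqP => [e|_]; last by rewrite scale0r.
    by case/eqP: ij; apply: val_inj.
  rewrite nth_default // big1 // => i _.
  rewrite eqnE; case: eqP => [e|_]; last by rewrite scale0r.
  by move: ij; rewrite e leqNgt ltn_ord.
- by rewrite IHa IHb -big_split; apply: eq_bigr => i _; rewrite scalerDl.
- by rewrite IHa -sumrN; apply: eq_bigr => i _; rewrite scaleNr.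
- by rewrite IHa scaler_sumr; apply: eq_bigr => i _; rewrite scalerA.
- by rewrite big1 // => i _; rewrite scale0r.
Qed.

(** A nested conjunction, so that [cbn] and [split] turn it into one scalar identity per atom. *)
Fixpoint vsame (n : nat) (a b : vexp) : Prop :=
  if n is m.+1 then vcoef m a = vcoef m b /\ vsame m a b else True.

Lemma vsame_eq env a b : vsame (size env) a b -> veval env a = veval env b.
Proof.
rewrite !vevalE => h; apply: eq_bigr => -[i ilt] _ /=; congr (_ *: _).
elim: (size env) ilt h => // n IHn; rewrite ltnS leq_eqVlt => /orP[/eqP->[]//|].
by move=> ilt [_]; exact: IHn.
Qed.

End VectorExpressions.

Ltac vfind x env :=
  lazymatch env with
  | x :: _ => constr:(0%N)
  | _ :: ?r => let k := vfind x r in constr:(S k)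
  end.
Ltac vmem x env :=
  lazymatch env with
  | x :: _ => constr:(true)
  | _ :: ?r => vmem x r
  | _ => constr:(false)
  end.
Ltac vatoms e env :=
  lazymatch e with
  | (?a + ?b)%R => let env := vatoms a env in vatoms b env
  | (- ?a)%R => vatoms a env
  | (?k *: ?a)%R => vatoms a env
  | GRing.zero => env
  | _ => let t := vmem e env in
         lazymatch t with true => env | false => constr:(e :: env) end
  end.
Ltac vreify K e env :=
  lazymatch e with
  | (?a + ?b)%R => let a := vreify K a env in let b := vreify K b env in
                   constr:(@VAdd K a b)
  | (- ?a)%R => let a := vreify K a env in constr:(@VOpp K a)
  | (?k *: ?a)%R => let a := vreify K a env in constr:(@VScale K k a)
  | GRing.zero => constr:(@VZero K)
  | _ => let i := vfind e env in constr:(@VVar K i)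
  end.
(* Proves an equality of linear combinations in [V] by comparing coefficients. *)
Ltac vring V :=
  lazymatch type of V with
  | GRing.Lmodule.type ?K =>
    lazymatch goal with
    | |- ?a = ?b =>
      let env := vatoms a (@nil V) in let env := vatoms b env in
      let ea := vreify K a env in let eb := vreify K b env in
      apply: (@vsame_eq K V env ea eb);
      cbn -[GRing.add GRing.mul GRing.opp GRing.one GRing.zero GRing.inv GRing.natmul];
      repeat split; try ring; try (field; by rewrite ?pnatr_eq0)
    end
  end.

(** * Vector lattices with a lattice seminorm *)

(** One structure serves E, E' and E'': with a mere lattice seminorm and no completeness, the dual
    of an instance is again an instance. *)
Record nlat (R : realType) := Nlat {
  nV :> lmodType R;
  nle : nV -> nV -> Prop;
  njoin : nV -> nV -> nV;
  nrm : nV -> R;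
  nle_refl : forall x, nle x x;
  nle_anti : forall x y, nle x y -> nle y x -> x = y;
  nle_trans : forall y x z, nle x y -> nle y z -> nle x z;
  nle_add : forall x y z, nle x y -> nle (x + z) (y + z);
  nle_scale : forall (a : R) x y, 0 <= a -> nle x y -> nle (a *: x) (a *: y);
  njoinl : forall x y, nle x (njoin x y);
  njoinr : forall x y, nle y (njoin x y);
  njoin_least : forall x y z, nle x z -> nle y z -> nle (njoin x y) z;
  nrmD : forall x y, nrm (x + y) <= nrm x + nrm y;
  nrmZ : forall (a : R) x, nrm (a *: x) = `|a| * nrm x;
  nrm_abs : forall x y, nle (njoin x (- x)) (njoin y (- y)) -> nrm x <= nrm y
}.
Arguments nle {R X} : rename, simpl never.
Arguments njoin {R X} : rename, simpl never.
Arguments nrm {R X} : rename, simpl never.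
Arguments nle_refl {R X} : rename.
Arguments nle_trans {R X} y {x z} : rename.
Arguments nle_add {R X} [x y] z : rename.
Arguments njoinl {R X} : rename.
Arguments njoinr {R X} : rename.

Notation "x [<=] y" := (nle x y) (at level 70).

Section VectorLattice.
Variables (R : realType) (X : nlat R).
Implicit Types x y z a b u v w p q : X.

Definition nmeet x y := x + y - njoin x y.
Definition npos x := njoin x 0.
Definition nabs x := njoin x (- x).

(* All order reasoning is done by exhibiting [y - x] as a combination of known differences. *)
Lemma nle_eq a b x y : a [<=] b -> y - x = b - a -> x [<=] y.
Proof.
move=> /(nle_add (x - a)) ab e.
have -> : x = a + (x - a) by vring (nV X).
have -> : y = b + (x - a) by have -> : y = (y - x) + x; [vring (nV X)|rewrite e; vring (nV X)].
exact: ab.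
Qed.

Lemma nle_addn a b c d : a [<=] b -> c [<=] d -> a + c [<=] b + d.
Proof.
move=> ab cd; apply: (nle_trans (b + c)); first exact: nle_add.
by apply: (nle_eq cd); vring (nV X).
Qed.

Lemma nle_sub x y : x [<=] y -> 0 [<=] y - x.
Proof. by move=> xy; apply: (nle_eq xy); vring (nV X). Qed.

Lemma nadd_ge0 x y : 0 [<=] x -> 0 [<=] y -> 0 [<=] x + y.
Proof. by move=> x0 y0; apply: (nle_eq (nle_addn x0 y0)); vring (nV X). Qed.

Lemma nscale_ge0 (t : R) x : 0 <= t -> 0 [<=] x -> 0 [<=] t *: x.
Proof. by move=> t0 /(nle_scale t0); rewrite scaler0. Qed.

Lemma nle_scalel (s t : R) x : 0 [<=] x -> s <= t -> s *: x [<=] t *: x.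
Proof.
move=> x0 st; have /nscale_ge0/(_ x0) h : 0 <= t - s by lra.
by apply: (nle_eq h); vring (nV X).
Qed.

Lemma nsum_ge0 (I : Type) (r : seq I) (P : pred I) (F : I -> X) :
  (forall i, P i -> 0 [<=] F i) -> 0 [<=] \sum_(i <- r | P i) F i.
Proof.
move=> F0; apply: (big_ind (fun v => 0 [<=] v)) => //; first exact: nle_refl.
exact: nadd_ge0.
Qed.

Lemma njoinC x y : njoin x y = njoin y x.
Proof.
by apply: nle_anti; apply: njoin_least; (exact: njoinl || exact: njoinr).
Qed.

Lemma njoinD x y z : njoin (x + z) (y + z) = njoin x y + z.
Proof.
apply: nle_anti.
  by apply: njoin_least; apply: nle_add; (exact: njoinl || exact: njoinr).
have h : njoin x y [<=] njoin (x + z) (y + z) - z.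
  apply: njoin_least.
    by apply: (nle_eq (njoinl (x + z) (y + z))); vring (nV X).
  by apply: (nle_eq (njoinr (x + z) (y + z))); vring (nV X).
by apply: (nle_eq h); vring (nV X).
Qed.

Lemma njoin_le2 x y x' y' : x [<=] x' -> y [<=] y' -> njoin x y [<=] njoin x' y'.
Proof.
move=> xx yy; apply: njoin_least.
  exact: nle_trans xx (njoinl _ _).
exact: nle_trans yy (njoinr _ _).
Qed.

Lemma njoinZ (t : R) x y : 0 <= t -> njoin (t *: x) (t *: y) = t *: njoin x y.
Proof.
rewrite le_eqVlt => /predU1P[<-|t0].
  rewrite !scale0r; apply: nle_anti; last exact: njoinl.
  by apply: njoin_least; exact: nle_refl.
have [t0' tn0] := (ltW t0, lt0r_neq0 t0).
apply: nle_anti.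
  by apply: njoin_least; apply: nle_scale => //; (exact: njoinl || exact: njoinr).
have ti : 0 <= t^-1 by rewrite invr_ge0.
have h : njoin x y [<=] t^-1 *: njoin (t *: x) (t *: y).
  apply: njoin_least.
    by have := nle_scale ti (njoinl (t *: x) (t *: y)); rewrite scalerA mulVf // scale1r.
  by have := nle_scale ti (njoinr (t *: x) (t *: y)); rewrite scalerA mulVf // scale1r.
by have := nle_scale t0' h; rewrite scalerA mulfV // scale1r.
Qed.

Lemma nmeetl x y : nmeet x y [<=] x.
Proof. by apply: (nle_eq (njoinr x y)); rewrite /nmeet; vring (nV X). Qed.

Lemma nmeetr x y : nmeet x y [<=] y.
Proof. by apply: (nle_eq (njoinl x y)); rewrite /nmeet; vring (nV X). Qed.

Lemma nmeet_greatest x y z : z [<=] x -> z [<=] y -> z [<=] nmeet x y.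
Proof.
move=> zx zy; have h : njoin x y [<=] x + y - z.
  apply: njoin_least; first by apply: (nle_eq zy); vring (nV X).
  by apply: (nle_eq zx); vring (nV X).
by apply: (nle_eq h); rewrite /nmeet; vring (nV X).
Qed.

Lemma nmeetC x y : nmeet x y = nmeet y x.
Proof. by rewrite /nmeet njoinC addrC [x + y]addrC addrC. Qed.

Lemma nmeet_le2 x y x' y' : x [<=] x' -> y [<=] y' -> nmeet x y [<=] nmeet x' y'.
Proof.
move=> xx yy; apply: nmeet_greatest.
  exact: nle_trans (nmeetl _ _) xx.
exact: nle_trans (nmeetr _ _) yy.
Qed.

Lemma nmeet_ge0 x y : 0 [<=] x -> 0 [<=] y -> 0 [<=] nmeet x y.
Proof. exact: nmeet_greatest. Qed.

Lemma npos_ge0 x : 0 [<=] npos x. Proof. exact: njoinr. Qed.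
Lemma npos_ge x : x [<=] npos x. Proof. exact: njoinl. Qed.

Lemma npos_le x y : x [<=] y -> npos x [<=] npos y.
Proof. by move=> xy; apply: njoin_least; [exact: nle_trans xy (njoinl _ _)|exact: njoinr]. Qed.

Lemma npos_least x y : 0 [<=] y -> x [<=] y -> npos x [<=] y.
Proof. by move=> y0 xy; exact: njoin_least. Qed.

Lemma nposB x : x = npos x - npos (- x).
Proof.
have := njoinD x 0 (- x); rewrite subrr add0r => e.
by rewrite [npos (- x)]/npos [njoin (- x) 0]njoinC e /npos; vring (nV X).
Qed.

Lemma nsub_pos x y : npos (x - y) = x - nmeet x y.
Proof.
rewrite /npos /nmeet; have := njoinD x y (- y); rewrite subrr => ->; vring (nV X).
Qed.

Lemma nabs_gel x : x [<=] nabs x. Proof. exact: njoinl. Qed.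
Lemma nabs_ger x : - x [<=] nabs x. Proof. exact: njoinr. Qed.

Lemma nabs_ge0 x : 0 [<=] nabs x.
Proof.
have h0 : 0 <= 2^-1 :> R by lra.
have h := nle_scale h0 (nle_addn (nabs_gel x) (nabs_ger x)).
by apply: (nle_eq h); vring (nV X).
Qed.

Lemma nabsN x : nabs (- x) = nabs x.
Proof. by rewrite /nabs opprK njoinC. Qed.

Lemma nabs_least x y : x [<=] y -> - x [<=] y -> nabs x [<=] y.
Proof. exact: njoin_least. Qed.

Lemma nabsE x : nabs x = npos x + npos (- x).
Proof.
set a := npos x; set b := npos (- x).
have xE : x = a - b := nposB x.
apply: nle_anti.
  apply: nabs_least; rewrite [in X in X [<=] _]xE.
    by apply: (nle_eq (nadd_ge0 (npos_ge0 (- x)) (npos_ge0 (- x)))); rewrite /b; vring (nV X).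
  by apply: (nle_eq (nadd_ge0 (npos_ge0 x) (npos_ge0 x))); rewrite /a; vring (nV X).
(* The reverse inequality follows from [x^+ <= (|x| + x) / 2], since [x^+ + x^- = 2 x^+ - x]. *)
have h : a [<=] 2^-1 *: (nabs x + x).
  apply: npos_least.
    apply: nscale_ge0; first by lra.
    by apply: (nle_eq (nabs_ger x)); vring (nV X).
  have h0 : 0 <= 2^-1 :> R by lra.
  by apply: (nle_eq (nle_scale h0 (nabs_gel x))); vring (nV X).
have h2 : 0 <= 2 :> R by lra.
apply: (nle_eq (nle_scale h2 h)).
have -> : b = a - x by rewrite {1}xE; vring (nV X).
by vring (nV X).
Qed.

Lemma nabs_id x : 0 [<=] x -> nabs x = x.
Proof.
move=> x0; apply: nle_anti; last exact: nabs_gel.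
apply: nabs_least; first exact: nle_refl.
by apply: (nle_eq (nadd_ge0 x0 x0)); vring (nV X).
Qed.

Lemma nabsD x y : nabs (x + y) [<=] nabs x + nabs y.
Proof.
apply: nabs_least; first exact: nle_addn (nabs_gel _) (nabs_gel _).
by rewrite opprD; exact: nle_addn (nabs_ger _) (nabs_ger _).
Qed.

Lemma nabsZ (t : R) x : nabs (t *: x) = `|t| *: nabs x.
Proof.
have [t0|/ltW t0] := leP 0 t; first by rewrite ger0_norm // -njoinZ // scalerN.
rewrite ler0_norm // -nabsN -scaleNr.
by rewrite /nabs -njoinZ ?oppr_ge0 // scalerN.
Qed.

Lemma nabs_le_sub x y z : 0 [<=] x -> x [<=] z -> 0 [<=] y -> y [<=] z -> nabs (x - y) [<=] z.
Proof.
move=> x0 xz y0 yz; apply: nabs_least.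
  by apply: (nle_eq (nle_addn xz y0)); vring (nV X).
by apply: (nle_eq (nle_addn yz x0)); vring (nV X).
Qed.

Lemma nrm0 : nrm (0 : X) = 0.
Proof. by rewrite -(scale0r (0 : X)) nrmZ normr0 mul0r. Qed.

Lemma nrmN x : nrm (- x) = nrm x.
Proof. by rewrite -scaleN1r nrmZ normrN1 mul1r. Qed.

Lemma nrm_ge0 x : 0 <= nrm x.
Proof. by have := nrmD x (- x); rewrite subrr nrm0 nrmN; lra. Qed.

Lemma nrm_le x y : nabs x [<=] y -> nrm x <= nrm y.
Proof.
move=> xy; apply: nrm_abs; apply: nle_trans xy _; exact: nabs_gel.
Qed.

Lemma nrm_nabs x : nrm (nabs x) = nrm x.
Proof.
have ha := nabs_id (nabs_ge0 x).
by apply/eqP; rewrite eq_le; apply/andP; split; apply: nrm_abs; rewrite -!/(nabs _) ha; exact: nle_refl.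
Qed.

Lemma nrm_pos_le x y : 0 [<=] x -> x [<=] y -> nrm x <= nrm y.
Proof. by move=> x0 xy; apply: nrm_le; rewrite nabs_id. Qed.

Lemma nrm_npos x : nrm (npos x) <= nrm x.
Proof.
rewrite -(nrm_nabs x); apply: nrm_pos_le; first exact: npos_ge0.
by apply: npos_least; [exact: nabs_ge0|exact: nabs_gel].
Qed.

(** The remainder [x - x /\ a] equals [x \/ a - a], and [a + b] is an upper bound of both [x] and
    [a]. *)
Lemma riesz_decomposition x a b : 0 [<=] x -> 0 [<=] a -> 0 [<=] b -> x [<=] a + b ->
  [/\ 0 [<=] nmeet x a, nmeet x a [<=] a, 0 [<=] x - nmeet x a & x - nmeet x a [<=] b].
Proof.
move=> x0 a0 b0 xab; split; [exact: nmeet_ge0|exact: nmeetr| |].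
- by apply: nle_sub; exact: nmeetl.
- have h : njoin x a [<=] a + b.
    by apply: njoin_least => //; apply: (nle_eq b0); vring (nV X).
  by apply: (nle_eq h); rewrite /nmeet; vring (nV X).
Qed.

Lemma nmeetDl p q w : 0 [<=] p -> 0 [<=] q -> 0 [<=] w ->
  nmeet (p + q) w [<=] nmeet p w + nmeet q w.
Proof.
move=> p0 q0 w0; set m := nmeet (p + q) w.
have m0 : 0 [<=] m by apply: nmeet_ge0 => //; exact: nadd_ge0.
have [h0 h1 h2 h3] := riesz_decomposition m0 p0 q0 (nmeetl _ _).
have mw : m [<=] w := nmeetr _ _.
have a1 : nmeet m p [<=] nmeet p w.
  by apply: nmeet_greatest => //; exact: nle_trans (nmeetl _ _) mw.
have a2 : m - nmeet m p [<=] nmeet q w.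
  apply: nmeet_greatest => //.
  by apply: (nle_eq (nle_addn mw h0)); vring (nV X).
by apply: (nle_eq (nle_addn a1 a2)); vring (nV X).
Qed.

Definition disj x y := nmeet x y = 0.

Lemma disj_sym x y : disj x y -> disj y x.
Proof. by rewrite /disj nmeetC. Qed.

Lemma disjW x y x' y' : 0 [<=] x -> x [<=] x' -> 0 [<=] y -> y [<=] y' ->
  disj x' y' -> disj x y.
Proof.
move=> x0 xx y0 yy d; apply: nle_anti; last exact: nmeet_ge0.
by rewrite -d; exact: nmeet_le2.
Qed.

Lemma disjD p q w : 0 [<=] p -> 0 [<=] q -> 0 [<=] w ->
  disj p w -> disj q w -> disj (p + q) w.
Proof.
move=> p0 q0 w0 pw qw; apply: nle_anti; last exact: nmeet_ge0 (nadd_ge0 _ _) _.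
by have := nmeetDl p0 q0 w0; rewrite pw qw addr0.
Qed.

Lemma disjZ (t : R) p w : 0 <= t -> 0 [<=] p -> 0 [<=] w -> disj p w -> disj (t *: p) w.
Proof.
(* [t + 1] dominates both [t] and [1], so the two elements lie below multiples of [p] and [w] by one
   common factor, which comes out of the meet. *)
move=> t0 p0 w0 pw; pose K := t + 1.
have K0 : 0 <= K by rewrite /K; lra.
apply: (@disjW _ _ (K *: p) (K *: w)) => //.
- exact: nscale_ge0.
- by apply: nle_scalel => //; rewrite /K; lra.
- by rewrite -[X in X [<=] _]scale1r; apply: nle_scalel => //; rewrite /K; lra.
- by rewrite /disj /nmeet njoinZ // -scalerDr -scalerBr -/(nmeet p w) pw scaler0.
Qed.

Lemma disj_pos_neg x : disj (npos x) (npos (- x)).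
Proof.
rewrite /disj /nmeet.
have -> : njoin (npos x) (npos (- x)) = nabs x.
  apply: nle_anti; last first.
    by apply: njoin_le2; exact: npos_ge.
  by apply: njoin_least; apply: npos_least;
    (exact: nabs_ge0 || exact: nabs_gel || exact: nabs_ger).
by rewrite nabsE subrr.
Qed.

(** For disjoint elements the sum is the join. *)
Lemma disj_add_le p q w : disj p q -> p [<=] w -> q [<=] w -> p + q [<=] w.
Proof.
by move=> d pw qw; rewrite (subr0_eq (d : p + q - njoin p q = 0)); exact: njoin_least.
Qed.

(** Disjointness makes [p] the positive part of [p - q]. *)
Lemma disj_abs_sub p q : 0 [<=] p -> 0 [<=] q -> disj p q -> p [<=] nabs (p - q).
Proof.
move=> p0 q0 d; have -> : p = npos (p - q) by rewrite nsub_pos d subr0.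
apply: npos_least; first exact: nabs_ge0.
by rewrite nsub_pos d subr0; exact: nabs_gel.
Qed.

End VectorLattice.

#[global] Hint Resolve nle_refl npos_ge0 npos_ge nabs_ge0 nabs_gel nabs_ger nadd_ge0
  nmeet_ge0 : core.
#[global] Hint Extern 0 (is_true (0 <= nrm _)) => exact: nrm_ge0 : core.

(** * Suprema of bounded sets of reals *)

Section Suprema.
Variable R : realType.
Implicit Types (A : set R) (M a : R).

Lemma ge_sup_mem A M a : (forall b, A b -> b <= M) -> A a -> a <= sup A.
Proof.
move=> AM Aa; apply: ub_le_sup => //; exists M => b; exact: AM.
Qed.

Lemma sup_bounded_le A M a : A a -> (forall b, A b -> b <= M) -> sup A <= M.
Proof. by move=> Aa AM; apply: ge_sup => //; exists a. Qed.

Lemma sup_near A M a (e : R) : 0 < e -> (forall b, A b -> b <= M) -> A a ->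
  exists2 b, A b & sup A - e < b.
Proof.
move=> e0 AM Aa; apply: sup_adherent => //; split; first by exists a.
by exists M => b; exact: AM.
Qed.

End Suprema.

(** * The dual lattice *)

Section Dual.
Variables (R : realType) (X : nlat R).
Implicit Types (x y z : X).

(** Boundedness replaces continuity because it makes sense for a seminorm without a topology; on E
    the two agree by [in_dual_bfun]. *)
Definition bfun (f : X -> R) :=
  (forall (a : R) x y, f (a *: x + y) = a * f x + f y) /\
  exists C, forall x, `|f x| <= C * nrm x.

Record dual := Dual { dfun :> X -> R; dualP : bfun dfun }.
Implicit Types f g h : dual.

Lemma dual_eq f g : (forall x, f x = g x) -> f = g.
Proof.
case: f g => [f fP] [g gP] /= fg; have /funext e : f =1 g by [].
by move: fP; rewrite e => fP; congr Dual; exact: Prop_irrelevance.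
Qed.

Lemma bfun0 : bfun (fun=> 0).
Proof. by split=> [a x y|]; [rewrite mulr0 addr0|exists 0 => x; rewrite normr0 mul0r]. Qed.

Lemma bfunD f g : bfun (fun x => f x + g x).
Proof.
case: f g => [f [fl [C fC]]] [g [gl [D gD]]] /=; split=> [a x y|].
  by rewrite fl gl; ring.
exists (C + D) => x; apply: le_trans (ler_normD _ _) _.
by rewrite mulrDl lerD.
Qed.

Lemma bfunZ (t : R) f : bfun (fun x => t * f x).
Proof.
case: f => [f [fl [C fC]]] /=; split=> [a x y|]; first by rewrite fl; ring.
by exists (`|t| * C) => x; rewrite normrM -mulrA ler_wpM2l.
Qed.

Lemma bfunN f : bfun (fun x => - f x).
Proof.
case: f => [f [fl [C fC]]] /=; split=> [a x y|]; first by rewrite fl; ring.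
by exists C => x; rewrite normrN.
Qed.

HB.instance Definition _ := gen_eqMixin dual.
HB.instance Definition _ := gen_choiceMixin dual.

Fact dual_addA : associative (fun f g => Dual (bfunD f g)).
Proof. by move=> f g h; apply: dual_eq => x /=; rewrite addrA. Qed.
Fact dual_addC : commutative (fun f g => Dual (bfunD f g)).
Proof. by move=> f g; apply: dual_eq => x /=; rewrite addrC. Qed.
Fact dual_add0 : left_id (Dual bfun0) (fun f g => Dual (bfunD f g)).
Proof. by move=> f; apply: dual_eq => x /=; rewrite add0r. Qed.
Fact dual_addN : left_inverse (Dual bfun0) (fun f => Dual (bfunN f)) (fun f g => Dual (bfunD f g)).
Proof. by move=> f; apply: dual_eq => x /=; rewrite addNr. Qed.

HB.instance Definition _ := GRing.isZmodule.Build dual dual_addA dual_addC dual_add0 dual_addN.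

Fact dual_scaleA (a b : R) f : Dual (bfunZ a (Dual (bfunZ b f))) = Dual (bfunZ (a * b) f).
Proof. by apply: dual_eq => x /=; rewrite mulrA. Qed.
Fact dual_scale1 : left_id 1 (fun (a : R) f => Dual (bfunZ a f)).
Proof. by move=> f; apply: dual_eq => x /=; rewrite mul1r. Qed.
Fact dual_scaleDr : right_distributive (fun (a : R) f => Dual (bfunZ a f)) +%R.
Proof. by move=> a f g; apply: dual_eq => x /=; rewrite mulrDr. Qed.
Fact dual_scaleDl f : {morph (fun (a : R) => Dual (bfunZ a f)) : a b / a + b}.
Proof. by move=> a b; apply: dual_eq => x /=; rewrite mulrDl. Qed.

HB.instance Definition _ := GRing.Zmodule_isLmodule.Build R dual
  dual_scaleA dual_scale1 dual_scaleDr dual_scaleDl.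

Lemma dualDE f g x : (f + g) x = f x + g x. Proof. by []. Qed.
Lemma dualNE f x : (- f) x = - f x. Proof. by []. Qed.
Lemma dualZE (t : R) f x : (t *: f) x = t * f x. Proof. by []. Qed.
Lemma dualD f x y : f (x + y) = f x + f y.
Proof. by have [fl _] := dualP f; have := fl 1 x y; rewrite scale1r mul1r. Qed.
Lemma dual0 f : f 0 = 0.
Proof. by have := dualD f 0 0; rewrite addr0; lra. Qed.
Lemma dualZ f (t : R) x : f (t *: x) = t * f x.
Proof. by have [fl _] := dualP f; have := fl t x 0; rewrite dual0 !addr0. Qed.
Lemma dualN f x : f (- x) = - f x.
Proof. by rewrite -scaleN1r dualZ mulN1r. Qed.
Lemma dualB f x y : f (x - y) = f x - f y.
Proof. by rewrite dualD dualN. Qed.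

Definition dle f g := forall x, 0 [<=] x -> f x <= g x.
(** Stated for bare functions, so that on E it is convertible to [dual_norm]. *)
Definition dnrm (f : X -> R) := sup [set `|f x| | x in [set x : X | nrm x <= 1]].

Lemma dnrm_bound f : exists2 M : R, 0 <= M & forall x, nrm x <= 1 -> `|f x| <= M.
Proof.
have [_ [C fC]] := dualP f; exists `|C| => // x x1; apply: le_trans (fC x) _.
apply: le_trans (ler_norm _) _; rewrite normrM -[leRHS]mulr1 ler_wpM2l //.
by rewrite ger0_norm // nrm_ge0.
Qed.

Lemma dnrm_unit f x : nrm x <= 1 -> `|f x| <= dnrm f.
Proof.
move=> x1; have [M _ fM] := dnrm_bound f.
by apply: (@ge_sup_mem _ _ M); [move=> _ [y y1 <-]; exact: fM|exists x].
Qed.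

Lemma dnrm_ge0 f : 0 <= dnrm f.
Proof. by have := @dnrm_unit f 0; rewrite dual0 normr0 nrm0 ler01; exact. Qed.

Lemma dualb f x : `|f x| <= dnrm f * nrm x.
Proof.
(* A nonzero vector may have seminorm [0]; the bound in [bfun] then forces [f x = 0]. *)
have [x0|x0] := eqVneq (nrm x) 0.
  by have [_ [C /(_ x)]] := dualP f; rewrite x0 !mulr0.
have xp : 0 < nrm x by rewrite lt0r x0 nrm_ge0.
have := @dnrm_unit f ((nrm x)^-1 *: x).
rewrite nrmZ ger0_norm ?invr_ge0 ?nrm_ge0 // mulVf // lexx => /(_ isT).
by rewrite dualZ normrM ger0_norm ?invr_ge0 ?nrm_ge0 // mulrC ler_pdivrMr.
Qed.

Lemma dualb_le f x : f x <= dnrm f * nrm x.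
Proof. exact: le_trans (ler_norm _) (dualb f x). Qed.

Lemma dnrm_le f (C : R) : 0 <= C -> (forall x, `|f x| <= C * nrm x) -> dnrm f <= C.
Proof.
move=> C0 fC; apply: (@sup_bounded_le _ _ _ 0).
  by exists 0; rewrite /= ?nrm0 // dual0 normr0.
move=> _ [x x1 <-]; apply: le_trans (fC x) _.
by rewrite -[leRHS]mulr1 ler_wpM2l.
Qed.

(* Riesz-Kantorovich formula for the positive part of [f]. *)
Definition kpos f x := sup [set f y | y in [set y : X | 0 [<=] y /\ y [<=] x]].

Lemma kpos_bound f x y : 0 [<=] y -> y [<=] x -> f y <= dnrm f * nrm x.
Proof.
move=> y0 yx; apply: le_trans (dualb_le _ _) _.
by rewrite ler_wpM2l ?dnrm_ge0 // nrm_pos_le.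
Qed.

Lemma kpos_ge f x y : 0 [<=] y -> y [<=] x -> f y <= kpos f x.
Proof.
move=> y0 yx; apply: (@ge_sup_mem _ _ (dnrm f * nrm x)); last by exists y.
by move=> _ [z [z0 zx] <-]; exact: kpos_bound.
Qed.

Lemma kpos_le f x (M : R) : 0 [<=] x ->
  (forall y, 0 [<=] y -> y [<=] x -> f y <= M) -> kpos f x <= M.
Proof.
move=> x0 h; apply: (@sup_bounded_le _ _ _ (f x)); last by move=> _ [y [y0 yx] <-]; exact: h.
by exists x => //; split=> //; exact: nle_refl.
Qed.

Lemma kpos_approx f x (e : R) : 0 < e -> 0 [<=] x ->
  exists y, [/\ 0 [<=] y, y [<=] x & kpos f x - e < f y].
Proof.
move=> e0 x0.
have [||_ [y [y0 yx] <-] ye] := @sup_near _ [set f y | y in [set y : X | 0 [<=] y /\ y [<=] x]] (dnrm f * nrm x) (f x) e e0.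
- by move=> _ [z [z0 zx] <-]; exact: kpos_bound.
- by exists x => //; split=> //; exact: nle_refl.
- by exists y.
Qed.

(** Riesz decomposition of the points of [[0, x + y]] gives one inequality; adding near-maximisers
    on [[0, x]] and [[0, y]] gives the other. *)
Lemma kposD f x y : 0 [<=] x -> 0 [<=] y -> kpos f (x + y) = kpos f x + kpos f y.
Proof.
move=> x0 y0; apply/eqP; rewrite eq_le; apply/andP; split.
  apply: kpos_le; first exact: nadd_ge0.
  move=> z z0 zxy; have [h0 h1 h2 h3] := riesz_decomposition z0 x0 y0 zxy.
  have -> : z = nmeet z x + (z - nmeet z x) by vring (nV X).
  by rewrite dualD lerD // kpos_ge.
apply/ler_addgt0Pr => e e0; have e20 : 0 < e / 2 by lra.
have [a [a0 ax ae]] := kpos_approx f e20 x0.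
have [b [b0 by_ be]] := kpos_approx f e20 y0.
have := @kpos_ge f (x + y) (a + b) (nadd_ge0 a0 b0) (nle_addn ax by_).
by rewrite dualD; lra.
Qed.

Lemma kposZ f (t : R) x : 0 <= t -> 0 [<=] x -> kpos f (t *: x) = t * kpos f x.
Proof.
move=> t0 x0; apply/eqP; rewrite eq_le; apply/andP; split.
  have [->|tn0] := eqVneq t 0.
    rewrite scale0r mul0r; apply: kpos_le; first exact: nle_refl.
    by move=> y y0 y0'; rewrite (nle_anti y0' y0) dual0.
  have tp : 0 < t by rewrite lt0r tn0.
  apply: kpos_le; first exact: nscale_ge0.
  move=> y y0 ytx; have ti : 0 <= t^-1 by rewrite invr_ge0.
  rewrite -[leLHS]mul1r -(mulfV tn0) -mulrA -dualZ ler_wpM2l //.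
  apply: kpos_ge; first exact: nscale_ge0.
  by have := nle_scale ti ytx; rewrite scalerA mulVf // scale1r.
have h (e : R) : 0 < e -> t * kpos f x <= kpos f (t *: x) + t * e.
  move=> e0; have [y [y0 yx ye]] := kpos_approx f e0 x0.
  have := @kpos_ge f (t *: x) (t *: y) (nscale_ge0 t0 y0) (nle_scale t0 yx).
  by rewrite dualZ; nra.
apply/ler_addgt0Pr => e e0.
(* Dividing by [t + 1] instead of [t] covers [t = 0]. *)
have t1 : 0 < t + 1 by lra.
have := h (e / (t + 1)) (divr_gt0 e0 t1).
have : t * (e / (t + 1)) <= e.
  by rewrite mulrA ler_pdivrMr //; nra.
lra.
Qed.

Definition kext f x := kpos f (npos x) - kpos f (npos (- x)).

(** The identity [(x - y)^+ + y = x + (x - y)^-] and additivity on the cone make the value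
    independent of the decomposition; linearity of [kext] rests on this. *)
Lemma kextE f x y : 0 [<=] x -> 0 [<=] y -> kext f (x - y) = kpos f x - kpos f y.
Proof.
move=> x0 y0; have e : npos (x - y) + y = x + npos (- (x - y)).
  have h := nposB (x - y).
  have -> : npos (x - y) = (x - y) + npos (- (x - y)) by rewrite {2}h; vring (nV X).
  by vring (nV X).
move: (congr1 (kpos f) e) => {e}.
by rewrite !kposD // /kext; lra.
Qed.

Lemma kext_pos f x : 0 [<=] x -> kext f x = kpos f x.
Proof.
move=> x0; have := kextE f x0 (nle_refl 0); rewrite subr0 => ->.
by have := kposZ f (lexx 0) x0; rewrite scale0r mul0r => ->; rewrite subr0.
Qed.

Lemma bfun_kext f : bfun (kext f).
Proof.
have kD x y : kext f (x + y) = kext f x + kext f y.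
  rewrite {1}(nposB x) {1}(nposB y).
  have -> : npos x - npos (- x) + (npos y - npos (- y)) =
    (npos x + npos y) - (npos (- x) + npos (- y)) by vring (nV X).
  rewrite kextE ?kposD //; try exact: nadd_ge0.
  by rewrite /kext; lra.
have kN x : kext f (- x) = - kext f x by rewrite /kext opprK; lra.
have kZ (t : R) x : 0 <= t -> kext f (t *: x) = t * kext f x.
  move=> t0; rewrite {1}(nposB x) scalerBr kextE ?kposZ //; try exact: nscale_ge0.
  by rewrite /kext; lra.
split=> [a x y|].
  rewrite kD; congr (_ + _); have [a0|/ltW a0] := leP 0 a; first exact: kZ.
  have := kZ (- a) x; rewrite scaleNr kN oppr_ge0 => /(_ a0); lra.
exists (2 * dnrm f) => x.
have k0 z : 0 [<=] z -> 0 <= kpos f z <= dnrm f * nrm z.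
  move=> z0; have := kpos_ge f (nle_refl 0) z0; rewrite dual0 => -> /=.
  by apply: kpos_le => // y; exact: kpos_bound.
have /andP[a0 a1] := k0 _ (npos_ge0 x).
have /andP[b0 b1] := k0 _ (npos_ge0 (- x)).
have := nrm_npos x; have := nrm_npos (- x); rewrite nrmN => c1 c2.
have := ler_wpM2l (dnrm_ge0 f) c1; have := ler_wpM2l (dnrm_ge0 f) c2.
by rewrite ler_norml /kext => ? ?; apply/andP; split; lra.
Qed.

Definition dpos f := Dual (bfun_kext f).
Definition djoin f g := g + dpos (f - g).

Lemma dle_anti f g : dle f g -> dle g f -> f = g.
Proof.
move=> fg gf; have h x : 0 [<=] x -> f x = g x.
  by move=> x0; apply/eqP; rewrite eq_le fg ?gf.
by apply: dual_eq => x; rewrite (nposB x) !dualB !h //; exact: npos_ge0.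
Qed.

Lemma dposE f x : 0 [<=] x -> dpos f x = kpos f x.
Proof. exact: kext_pos. Qed.

Lemma djoinl f g : dle f (djoin f g).
Proof.
move=> x x0; rewrite dualDE dposE //.
by have := kpos_ge (f - g) x0 (nle_refl x); rewrite dualDE dualNE; lra.
Qed.

Lemma djoinr f g : dle g (djoin f g).
Proof.
move=> x x0; rewrite dualDE dposE //.
by have := kpos_ge (f - g) (nle_refl 0) x0; rewrite dual0; lra.
Qed.

Lemma djoin_least f g h : dle f h -> dle g h -> dle (djoin f g) h.
Proof.
move=> fh gh x x0; rewrite dualDE dposE //.
suff : kpos (f - g) x <= h x - g x by lra.
apply: kpos_le => // y y0 yx; rewrite dualDE dualNE.
have := fh _ y0; have := gh _ (nle_sub yx); rewrite !dualB; lra.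
Qed.

Lemma dabs_ge f x : `|f x| <= djoin f (- f) (nabs x).
Proof.
rewrite nabsE dualD {1}(nposB x) dualB.
have := djoinl f (- f) (npos_ge0 x); have := djoinr f (- f) (npos_ge0 x).
have := djoinl f (- f) (npos_ge0 (- x)); have := djoinr f (- f) (npos_ge0 (- x)).
by rewrite !dualNE ler_norml => ? ? ? ?; apply/andP; split; lra.
Qed.

(** Here [f \/ -f = -f + (2 f)^+], and [2 f y - f x = f (y - (x - y))] for [y] in [[0, x]], where
    [|y - (x - y)| <= x]. *)
Lemma dabs_le f x : 0 [<=] x -> djoin f (- f) x <= dnrm f * nrm x.
Proof.
move=> x0; rewrite dualDE dposE //.
suff : kpos (f - - f) x <= f x + dnrm f * nrm x by rewrite dualNE; lra.
apply: kpos_le => // y y0 yx; rewrite dualDE !dualNE.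
have xy0 := nle_sub yx.
have : nrm (y - (x - y)) <= nrm x.
  apply: nrm_le; apply: nabs_le_sub => //.
  by apply: (nle_eq y0); vring (nV X).
move=> /(ler_wpM2l (dnrm_ge0 f)); have := dualb_le f (y - (x - y)).
by rewrite !dualB; lra.
Qed.

Lemma dnrm_abs f g : dle (djoin f (- f)) (djoin g (- g)) -> dnrm f <= dnrm g.
Proof.
move=> fg; apply: dnrm_le => [|x]; first exact: dnrm_ge0.
apply: le_trans (dabs_ge _ _) _; apply: le_trans (fg _ (nabs_ge0 x)) _.
by apply: le_trans (dabs_le _ (nabs_ge0 x)) _; rewrite nrm_nabs.
Qed.

Lemma dnrmD f g : dnrm (f + g : dual) <= dnrm f + dnrm g.
Proof.
apply: dnrm_le => [|x]; first by rewrite addr_ge0 ?dnrm_ge0.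
by rewrite mulrDl; apply: le_trans (ler_normD _ _) _; rewrite lerD ?dualb.
Qed.

Lemma dnrmZ (t : R) f : dnrm (t *: f : dual) = `|t| * dnrm f.
Proof.
have h (s : R) g : dnrm (s *: g : dual) <= `|s| * dnrm g.
  apply: dnrm_le => [|x]; first by rewrite mulr_ge0 ?dnrm_ge0.
  by rewrite dualZE normrM -mulrA ler_wpM2l // dualb.
apply/eqP; rewrite eq_le; apply/andP; split; first exact: h.
have [->|t0] := eqVneq t 0; first by rewrite normr0 mul0r; exact: dnrm_ge0.
have := h t^-1 (t *: f); rewrite scalerA mulVf // scale1r normfV.
by move=> /(ler_wpM2l (normr_ge0 t)); rewrite mulrA mulfV ?normr_eq0 // mul1r.
Qed.

(** Closed by [Defined], so that its order and norm are convertible to [dle] and [dnrm]. *)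
Definition dnlat : nlat R.
Proof.
refine (@Nlat R dual dle djoin dnrm _ dle_anti _ _ _ djoinl djoinr djoin_least dnrmD dnrmZ dnrm_abs).
- by move=> f x.
- by move=> g f h fg gh x x0; exact: le_trans (fg _ x0) (gh _ x0).
- by move=> f g h fg x x0; rewrite !dualDE lerD ?fg.
- by move=> a f g a0 fg x x0; rewrite !dualZE ler_wpM2l ?fg.
Defined.

End Dual.

(** * The Hahn-Banach theorem *)

Section HahnBanach.
Variables (R : realType) (V : lmodType R).
Implicit Types (p q : V -> R) (u v w d : V).

Definition sublin p :=
  (forall u v, p (u + v) <= p u + p v) /\
  (forall (a : R) v, 0 <= a -> p (a *: v) = a * p v).

Definition lin (f : V -> R) := forall (a : R) u v, f (a *: u + v) = a * f u + f v.

(** A convex cone in V x R; a pair [(d, t)] stands for the constraint [t <= f d] on the functional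
    sought. *)
Definition vcone (K : V -> R -> Prop) :=
  [/\ K 0 0, forall u v s t, K u s -> K v t -> K (u + v) (s + t) &
      forall (a : R) v t, 0 <= a -> K v t -> K (a *: v) (a * t)].

Lemma lin0 f : lin f -> f 0 = 0.
Proof. by move=> fl; have := fl 1 0 0; rewrite scaler0 addr0; lra. Qed.

Lemma linN f v : lin f -> f (- v) = - f v.
Proof. by move=> fl; have := fl (-1) v 0; rewrite addr0 scaleN1r lin0 //; lra. Qed.

Lemma sublin0 p : sublin p -> p 0 = 0.
Proof. by case=> _ h; have := h 0 0 (lexx _); rewrite scale0r mul0r. Qed.

Lemma sublinN p v : sublin p -> - p (- v) <= p v.
Proof. by move=> ps; have := ps.1 v (- v); rewrite subrr sublin0 //; lra. Qed.

(** Applying the scaling inequality to [a^-1] gives its converse. *)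
Lemma sublinP p : (forall u v, p (u + v) <= p u + p v) ->
  (forall (a : R) v, 0 < a -> p (a *: v) <= a * p v) -> p 0 = 0 -> sublin p.
Proof.
move=> pD pZ p0; split=> // a v; rewrite le_eqVlt => /predU1P[<-|a0].
  by rewrite scale0r mul0r.
apply/eqP; rewrite eq_le pZ //=; have ai : 0 < a^-1 by rewrite invr_gt0.
have := pZ _ (a *: v) ai; rewrite scalerA mulVf ?lt0r_neq0 // scale1r.
by move=> /(ler_wpM2l (ltW a0)); rewrite mulrA mulfV ?lt0r_neq0 // mul1r.
Qed.

Section ConeInfimum.
Variables (p : V -> R) (K : V -> R -> Prop).
Hypotheses (ps : sublin p) (Kc : vcone K) (Kp : forall d t, K d t -> t <= p d).

(** [cone_inf] is the infimum of [p (v + d) - t] over [K], as a negated supremum. A linear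
    functional below it lies below [p] and meets the constraints of [K]. *)
Let S v := [set r | exists d t, K d t /\ r = t - p (v + d)].
Definition cone_inf v := - sup (S v).

Let Sub v r : S v r -> r <= p (- v).
Proof.
case=> d [t [/Kp Kdt ->]]; have := ps.1 (v + d) (- v).
by rewrite addrAC subrr add0r; lra.
Qed.

Let S0 v : S v (- p v).
Proof. by have [K0 _ _] := Kc; exists 0, 0; rewrite addr0 sub0r. Qed.

Lemma cone_inf_le v d t : K d t -> cone_inf v <= p (v + d) - t.
Proof.
move=> Kdt; suff : t - p (v + d) <= sup (S v) by rewrite /cone_inf; lra.
by apply: ge_sup_mem; [exact: Sub|exists d, t].
Qed.

Lemma cone_inf_approx v (e : R) : 0 < e ->
  exists d t, K d t /\ p (v + d) - t < cone_inf v + e.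
Proof.
move=> e0; have [_ [d [t [Kdt ->]]] h] := sup_near e0 (@Sub v) (S0 v).
by exists d, t; split=> //; rewrite /cone_inf; lra.
Qed.

Lemma sublin_cone_inf : sublin cone_inf.
Proof.
have [K0 KD KZ] := Kc; apply: sublinP.
- move=> u v; apply/ler_addgt0Pr => e e0; have e2 : 0 < e / 2 by lra.
  have [d [s [Kd hd]]] := cone_inf_approx u e2.
  have [c [t [Kt hc]]] := cone_inf_approx v e2.
  have := cone_inf_le (u + v) (KD _ _ _ _ Kd Kt).
  by rewrite addrACA; have := ps.1 (u + d) (v + c); lra.
- move=> a v a0; apply/ler_addgt0Pr => e e0.
  have [d [t [Kd hd]]] := cone_inf_approx v (divr_gt0 e0 a0).
  have := cone_inf_le (a *: v) (KZ _ _ _ (ltW a0) Kd).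
  rewrite -scalerDr ps.2; last exact: ltW.
  have : a * (p (v + d) - t) <= a * (cone_inf v + e / a) by rewrite ler_wpM2l // ltW.
  by rewrite !mulrDr [a * (e / a)]mulrCA mulfV ?lt0r_neq0 //; lra.
- apply/eqP; rewrite eq_le; apply/andP; split.
    by have := cone_inf_le 0 K0; rewrite addr0 subr0 (sublin0 ps).
  rewrite /cone_inf oppr_ge0.
  apply: (@sup_bounded_le _ _ _ _ (S0 0)) => r /Sub.
  by rewrite oppr0 (sublin0 ps).
Qed.

End ConeInfimum.

(* A minimal sublinear functional is linear, because [cone_inf] along the ray
   through [w] lowers it strictly unless it is additive at [w]. *)
Lemma hahn_banach p : sublin p -> exists f, lin f /\ forall v, f v <= p v.
Proof.
move=> ps; pose T := {q | sublin q /\ forall v, q v <= p v}.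
(* The order is reversed: a maximal element for [le] is a minimal sublinear functional below [p]. *)
pose le (q1 q2 : T) := `[< forall v, sval q2 v <= sval q1 v >].
have [||||[q [qs qp]] qmin] := @Zorn T le.
- by move=> q; apply/asboolP.
- move=> a b c /asboolP ab /asboolP bc; apply/asboolP => v.
  exact: le_trans (bc v) (ab v).
- move=> [a ah] [b bh] /asboolP /= ab /asboolP /= ba; apply/eq_exist/funext => v.
  by apply/eqP; rewrite eq_le ab ba.
(* The empty chain is bounded by [p], a nonempty one by its pointwise infimum. *)
- move=> A Atot; have [[a0 Aa0]|An] := pselect (exists a, A a); last first.
    by exists (exist _ p (conj ps (fun v => lexx (p v)))) => s As; case: An; exists s.
  pose S v := [set r | exists2 a, A a & r = - sval a v].
  have Sub v r : S v r -> r <= p (- v).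
    case=> -[a [as_ ap]] _ -> /=; have := sublinN v as_; have := ap (- v); lra.
  have S0 v : S v (- sval a0 v) by exists a0.
  pose q v := - sup (S v).
  have qle a v : A a -> q v <= sval a v.
    move=> Aa; suff : - sval a v <= sup (S v) by rewrite /q; lra.
    by apply: ge_sup_mem; [exact: Sub|exists a].
  have qap v (e : R) : 0 < e -> exists2 a, A a & sval a v < q v + e.
    move=> e0; have [_ [a Aa ->] h] := sup_near e0 (@Sub v) (S0 v).
    by exists a => //; rewrite /q; lra.
  have qs : sublin q.
    apply: sublinP.
    + move=> u v; apply/ler_addgt0Pr => e e0; have e2 : 0 < e / 2 by lra.
      have [a Aa ha] := qap u _ e2; have [b Ab hb] := qap v _ e2.
      have [c Ac [cu cv]] : exists2 c, A c & sval c u <= sval a u /\ sval c v <= sval b v.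
        by have [/asboolP ab|/asboolP ba] := Atot _ _ Aa Ab; [exists b|exists a].
      by have := qle _ (u + v) Ac; have := (svalP c).1.1 u v; lra.
    + move=> a v a0'; apply/ler_addgt0Pr => e e0.
      have [b Ab hb] := qap v _ (divr_gt0 e0 a0').
      have := qle _ (a *: v) Ab; rewrite (svalP b).1.2; last exact: ltW.
      have : a * sval b v <= a * (q v + e / a) by rewrite ler_wpM2l // ltW.
      by rewrite !mulrDr [a * (e / a)]mulrCA mulfV ?lt0r_neq0 //; lra.
    + rewrite /q [S 0](_ : _ = [set 0]) ?sup1 ?oppr0 //.
      apply/seteqP; split=> [r [a _ ->]|_ ->].
        by rewrite /= sublin0 ?oppr0 //; case: (svalP a).
      by exists a0 => //; rewrite sublin0 ?oppr0 //; case: (svalP a0).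
  have qp v : q v <= p v by apply: le_trans (qle _ v Aa0) _; have [] := svalP a0.
  by exists (exist _ q (conj qs qp)) => s As; apply/asboolP => v; exact: qle.
exists q; split=> //.
have qD w v : q v + q w <= q (v + w).
  (* For the ray through [w], minimality identifies [cone_inf] with [q], which is therefore at most
     [q (v + w) - q w] at [v]. *)
  pose K d t := exists2 a : R, 0 <= a & d = a *: w /\ t = a * q w.
  have Kc : vcone K.
    split.
    - by exists 0 => //; rewrite scale0r mul0r.
    - move=> _ _ _ _ [a a0 [-> ->]] [b b0 [-> ->]].
      by exists (a + b); rewrite ?addr_ge0 // scalerDl mulrDl.
    - move=> c _ _ c0 [a a0 [-> ->]].
      by exists (c * a); rewrite ?mulr_ge0 // scalerA mulrA.
  have Kq d t : K d t -> t <= q d by move=> [a a0 [-> ->]]; rewrite qs.2.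
  have cs := sublin_cone_inf qs Kc Kq.
  have K0 : K 0 0 by case: Kc.
  have cq u : cone_inf q K u <= q u.
    by have := cone_inf_le qs Kq u K0; rewrite addr0 subr0.
  have cp u : cone_inf q K u <= p u := le_trans (cq u) (qp u).
  have := qmin (exist _ _ (conj cs cp)).
  rewrite /le /= => /(_ (asboolT cq)) => /(congr1 sval)/= e.
  have K1 : K w (q w) by exists 1 => //; rewrite scale1r mul1r.
  have := cone_inf_le qs Kq v K1; rewrite e; lra.
have qN v : q (- v) = - q v.
  apply/eqP; rewrite eq_le; apply/andP; split.
    by have := qD v (- v); rewrite addNr sublin0 //; lra.
  by have := sublinN v qs; lra.
move=> a u v.
have -> : q (a *: u + v) = q (a *: u) + q v.
  by apply/eqP; rewrite eq_le qs.1 qD.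
congr (_ + _); have [a0|/ltW a0] := leP 0 a; first exact: qs.2.
by have := qs.2 (- a) u; rewrite scaleNr qN oppr_ge0 => /(_ a0); lra.
Qed.

(** The constraint at [d] comes from evaluating at [- d], where [cone_inf] is at most
    [p 0 - t = - t]. *)
Lemma hahn_banach_sandwich p K : sublin p -> vcone K -> (forall d t, K d t -> t <= p d) ->
  exists f, [/\ lin f, forall v, f v <= p v & forall d t, K d t -> t <= f d].
Proof.
move=> ps Kc Kp; have [f [fl fp]] := hahn_banach (sublin_cone_inf ps Kc Kp).
have K0 : K 0 0 by case: Kc.
exists f; split=> //.
  move=> v; apply: le_trans (fp v) _.
  by have := cone_inf_le ps Kp v K0; rewrite addr0 subr0.
move=> d t Kdt; have := cone_inf_le ps Kp (- d) Kdt; have := fp (- d).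
by rewrite addNr sublin0 // linN //; lra.
Qed.

End HahnBanach.

(** * Limits along an ultrafilter *)

Section UltraLimit.
Variable R : realType.
Implicit Types h : nat -> R.

Lemma exists_ultra : exists U : set_system nat, UltraFilter U /\ \oo `<=` U.
Proof. exact: ultraFilterLemma. Qed.

(** A fixed ultrafilter gives all bounded sequences a linear limit and stands in for weak*
    compactness arguments with subnets. *)
Definition U0 : set_system nat := projT1 (cid exists_ultra).

Lemma U0_ultra : UltraFilter U0.
Proof. by rewrite /U0; case: (cid exists_ultra) => U []. Qed.

Lemma U0_oo : \oo `<=` U0.
Proof. by rewrite /U0; case: (cid exists_ultra) => U []. Qed.

#[local] Instance U0_proper : ProperFilter U0.
Proof. exact: (@ultra_proper _ _ U0_ultra). Qed.

Definition ulim h : R := lim (h n @[n --> U0]).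

(** The image of an ultrafilter is an ultrafilter, and here it lives on the compact segment
    [[-C, C]]. *)
Lemma ulim_cvg h (C : R) : (forall n, `|h n| <= C) -> h n @[n --> U0] --> ulim h.
Proof.
move=> hC; apply/cvg_ex.
have := @segment_compact R (- C) C; rewrite compact_ultra.
have hU : UltraFilter (h n @[n --> U0]).
  split=> [|G GP hG]; first exact: fmap_proper_filter.
  apply/seteqP; split; last exact: hG.
  move=> A GA.
  have [UA|UA] := in_ultra_setVsetC (h @^-1` A) U0_ultra; first exact: UA.
  have GnA : G (~` A) by apply: hG.
  by case: (@filter_not_empty _ G GP); rewrite -(setICr A); exact: filterI.
move=> /(_ (h n @[n --> U0]) hU) [].
  apply: U0_oo; exists 0%N => // n _ /=.
  by rewrite in_itv /= -ler_norml.
by move=> l [_ hl]; exists l.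
Qed.

Lemma ulimD g h (C D : R) : (forall n, `|g n| <= C) -> (forall n, `|h n| <= D) ->
  ulim (fun n => g n + h n) = ulim g + ulim h.
Proof.
by move=> /ulim_cvg gC /ulim_cvg hD; apply: cvg_lim => //; exact: cvgD.
Qed.

Lemma ulimZ (a : R) h (C : R) : (forall n, `|h n| <= C) ->
  ulim (fun n => a * h n) = a * ulim h.
Proof. by move=> /ulim_cvg hC; apply: cvg_lim => //; apply: cvgM => //; exact: cvg_cst. Qed.

Lemma ulim_ge h (C c : R) (N : nat) : (forall n, `|h n| <= C) ->
  (forall n, (N <= n)%N -> c <= h n) -> c <= ulim h.
Proof.
move=> /ulim_cvg hC ch; rewrite -(cvg_lim _ hC) //; apply: limr_ge.
  by apply/cvg_ex; exists (ulim h).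
by apply: U0_oo; exists N.
Qed.

Lemma ulim_le h (C c : R) (N : nat) : (forall n, `|h n| <= C) ->
  (forall n, (N <= n)%N -> h n <= c) -> ulim h <= c.
Proof.
move=> /ulim_cvg hC ch; rewrite -(cvg_lim _ hC) //; apply: limr_le.
  by apply/cvg_ex; exists (ulim h).
by apply: U0_oo; exists N.
Qed.

End UltraLimit.

(** * The pairing between a lattice and its dual *)

Section Pairing.
Variables (R : realType) (X : nlat R).
Implicit Types (f g : dnlat X) (x y : X).

Definition ap f x : R := (f : dual X) x.

Lemma apD f x y : ap f (x + y) = ap f x + ap f y. Proof. exact: dualD. Qed.
Lemma apZ f (t : R) x : ap f (t *: x) = t * ap f x. Proof. exact: dualZ. Qed.
Lemma apN f x : ap f (- x) = - ap f x. Proof. exact: dualN. Qed.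
Lemma apB f x y : ap f (x - y) = ap f x - ap f y. Proof. exact: dualB. Qed.
Lemma ap0 f : ap f 0 = 0. Proof. exact: dual0. Qed.
Lemma apDl f g x : ap (f + g) x = ap f x + ap g x. Proof. by []. Qed.
Lemma apZl f (t : R) x : ap (t *: f) x = t * ap f x. Proof. by []. Qed.
Lemma apNl f x : ap (- f) x = - ap f x. Proof. by []. Qed.
Lemma apBl f g x : ap (f - g) x = ap f x - ap g x. Proof. by []. Qed.
Lemma ap0l x : ap 0 x = 0. Proof. by []. Qed.

Lemma ap_suml (I : Type) (r : seq I) (F : I -> dnlat X) x :
  ap (\sum_(i <- r) F i) x = \sum_(i <- r) ap (F i) x.
Proof. by elim/big_rec2: _ => // i ? ? _ <-; rewrite apDl. Qed.

Lemma ap_le f g x : f [<=] g -> 0 [<=] x -> ap f x <= ap g x.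
Proof. by move=> fg; exact: fg. Qed.

Lemma ap_leP f g : (forall x, 0 [<=] x -> ap f x <= ap g x) -> f [<=] g.
Proof. by []. Qed.

Lemma ap_ge0 f x : 0 [<=] f -> 0 [<=] x -> 0 <= ap f x.
Proof. by move=> f0 x0; rewrite -(ap0l x); exact: ap_le. Qed.

Lemma ap_mono f x y : 0 [<=] f -> x [<=] y -> ap f x <= ap f y.
Proof. by move=> f0 /nle_sub/(ap_ge0 f0); rewrite apB; lra. Qed.

Lemma apb f x : `|ap f x| <= nrm f * nrm x. Proof. exact: dualb. Qed.

Lemma apb_le f x : ap f x <= nrm f * nrm x. Proof. exact: dualb_le. Qed.

Lemma nrm_dual_le f (C : R) : 0 <= C -> (forall x, `|ap f x| <= C * nrm x) -> nrm f <= C.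
Proof. exact: dnrm_le. Qed.

(** A positive [f] satisfies [|f x| <= f |x|], so near-maximisers may be taken positive. *)
Lemma nrm_dual_approx f (r : R) : 0 [<=] f -> r < nrm f ->
  exists x, [/\ 0 [<=] x, nrm x <= 1 & r < ap f x].
Proof.
move=> f0 rf; have [M _ fM] := dnrm_bound f.
have [|||_ [x x1 <-] hx] := @sup_near R [set `|ap f x| | x in [set x : X | nrm x <= 1]]
  M `|ap f 0| (nrm f - r).
- by lra.
- by move=> _ [x x1 <-]; exact: fM.
- by exists 0; rewrite //= nrm0.
exists (nabs x); split; [exact: nabs_ge0|by rewrite nrm_nabs|].
have h : `|ap f x| <= ap f (nabs x).
  rewrite ler_norml -lerN2 opprK -apN.
  by rewrite !ap_mono.
have {}hx : nrm f - (nrm f - r) < `|ap f x| := hx.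
lra.
Qed.

Lemma ap_posE f x : 0 [<=] x -> ap (npos f) x = kpos f x.
Proof.
move=> x0; rewrite -(dposE f x0).
have -> : ap (npos f) x = 0 + dpos ((f : dual X) - 0) x by [].
by rewrite add0r subr0.
Qed.

Lemma ap_pos_le f x (M : R) : 0 [<=] x ->
  (forall y, 0 [<=] y -> y [<=] x -> ap f y <= M) -> ap (npos f) x <= M.
Proof.
move=> x0 h; rewrite ap_posE //.
exact: kpos_le.
Qed.

Lemma ap_pos_approx f x (e : R) : 0 < e -> 0 [<=] x ->
  exists y, [/\ 0 [<=] y, y [<=] x & ap (npos f) x - e < ap f y].
Proof.
move=> e0 x0; rewrite ap_posE //.
exact: kpos_approx.
Qed.

Lemma ap_abs f x : `|ap f x| <= ap (nabs f) (nabs x). Proof. exact: dabs_ge. Qed.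

Definition mkdual (f : X -> R) (fb : bfun f) : dnlat X := Dual fb.

(** A form of Banach-Alaoglu: [g] is the pointwise ultrafilter limit, recorded through the eventual
    bounds that it inherits. *)
Lemma dual_ulim (F : nat -> dnlat X) (C : R) : (forall n, nrm (F n) <= C) ->
  exists g : dnlat X, forall x (c : R) N,
    ((forall n, (N <= n)%N -> c <= ap (F n) x) -> c <= ap g x) /\
    ((forall n, (N <= n)%N -> ap (F n) x <= c) -> ap g x <= c).
Proof.
move=> FC; have Fb x n : `|ap (F n) x| <= C * nrm x.
  by apply: le_trans (apb _ _) _; rewrite ler_wpM2r // nrm_ge0.
pose g x := ulim (fun n => ap (F n) x).
have gb : bfun g.
  split=> [a x y|].
    rewrite /g -(ulimZ a (Fb x)) -(@ulimD _ _ _ (`|a| * (C * nrm x)) (C * nrm y)) //.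
      by congr ulim; apply/funext => n; rewrite apD apZ.
    by move=> n; rewrite normrM ler_wpM2l.
  exists C => x; rewrite ler_norml; apply/andP; split.
    apply: (@ulim_ge _ _ _ _ 0%N (Fb x)) => n _.
    by have := Fb x n; rewrite ler_norml => /andP[].
  apply: (@ulim_le _ _ _ _ 0%N (Fb x)) => n _.
  by have := Fb x n; rewrite ler_norml => /andP[].
exists (mkdual gb) => x c N; split; [exact: ulim_ge (Fb x)|exact: ulim_le (Fb x)].
Qed.

End Pairing.
#[global] Arguments mkdual {R X f}.

(** * The canonical embedding into the bidual *)

Section Evaluation.
Variables (R : realType) (X : nlat R).
Implicit Types (f g : dnlat X) (x y : X).

Lemma bfun_ev x : bfun (fun f : dnlat X => ap f x).
Proof.
split=> [a f g|]; first by rewrite apDl apZl.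
by exists (nrm x) => f; rewrite mulrC; exact: apb.
Qed.

Definition ev x : dnlat (dnlat X) := mkdual (bfun_ev x).

Lemma evE x f : ap (ev x) f = ap f x. Proof. by []. Qed.

Lemma ev_ge0 x : 0 [<=] x -> 0 [<=] ev x.
Proof. by move=> x0; apply: ap_leP => f f0; rewrite evE ap0l; exact: ap_ge0. Qed.

Lemma nrm_ev_le x : nrm (ev x) <= nrm x.
Proof. by apply: nrm_dual_le => [|f]; rewrite ?nrm_ge0 // evE mulrC; exact: apb. Qed.

End Evaluation.

Lemma half_pow_small (R : realType) (c e : R) : 0 < e ->
  exists N, forall n, (N <= n)%N -> (2^-1) ^+ n * c <= e.
Proof.
move=> e0; have h0 : 0 <= `|c| / e by rewrite divr_ge0 // ltW.
exists (Num.bound (`|c| / e)) => n Nn.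
have hn : `|c| / e <= 2 ^+ n.
  apply: le_trans (ltW (archi_boundP h0)) _.
  by rewrite -natrX ler_nat; apply: leq_trans Nn (ltnW (ltn_expl _ _)).
have p0 : 0 < 2 ^+ n :> R by rewrite exprn_gt0.
rewrite exprVn mulrC ler_pdivrMr //; apply: le_trans (ler_norm c) _.
by move: hn; rewrite ler_pdivrMr // mulrC.
Qed.

(** * Almost order boundedness of the dual unit ball *)

Section AlmostOrderBounded.
Variables (R : realType) (X : nlat R) (phi : dnlat (dnlat X)).
Hypothesis phi0 : 0 [<=] phi.
Hypothesis phi_disj : forall v : nat -> dnlat X, (forall n, 0 [<=] v n) ->
  (forall n, nrm (v n) <= 1) -> (forall m n, (m < n)%N -> disj (v m) (v n)) ->
  forall e : R, 0 < e -> exists n, ap phi (v n) < e.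

(* If no [u] works, a gliding hump and a disjointification produce a disjoint
   sequence on which [phi] stays away from [0]. *)
Lemma almost_order_bounded (e : R) : 0 < e -> exists u : dnlat X, 0 [<=] u /\
  forall f, 0 [<=] f -> nrm f <= 1 -> ap phi (npos (f - u)) <= e.
Proof.
move=> e0; apply: contrapT => H.
have {}H u : exists f : dnlat X, 0 [<=] u ->
    [/\ 0 [<=] f, nrm f <= 1 & e < ap phi (npos (f - u))].
  apply: contrapT => Hu; apply: H; exists u.
  have [u0|u0] := pselect (0 [<=] u); last by case: Hu; exists 0.
  split=> // f f0 f1; rewrite leNgt; apply/negP => fe.
  by apply: Hu; exists f.
have [ch chP] := choice H.
(* [S n] accumulates the earlier choices, and [f n] is chosen against [u = 4 ^ n *: S n]. *)
pose S := fix S n := if n is m.+1 then S m + ch (4 ^+ m *: S m) else 0.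
pose f n := ch (4 ^+ n *: S n).
have q0 n : 0 <= 4 ^+ n :> R by rewrite exprn_ge0.
have S0 n : 0 [<=] S n.
  elim: n => [|n IH] /=; first exact: nle_refl.
  by apply: nadd_ge0 => //; have [] := chP _ (nscale_ge0 (q0 n) IH).
have fP n : [/\ 0 [<=] f n, nrm (f n) <= 1 & e < ap phi (npos (f n - 4 ^+ n *: S n))].
  exact: chP (nscale_ge0 (q0 n) (S0 n)).
have f0 n : 0 [<=] f n by case: (fP n).
have fS m n : (m < n)%N -> f m [<=] S n.
  elim: n => // n IH; rewrite ltnS leq_eqVlt => /predU1P[->|/IH fS].
    by apply: (nle_eq (S0 n)); rewrite /= -/(f n); vring (nV (dnlat X)).
  by apply: (nle_eq (nle_addn fS (f0 n))); rewrite /= -/(f n); vring (nV (dnlat X)).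
have h0 n : 0 <= (2^-1) ^+ n :> R by rewrite exprn_ge0 // invr_ge0.
(* The partial sums have norm at most [2]; their ultrafilter limit [fs] plays the role of the
   infinite sum, and what matters is that it dominates each term. *)
pose P K := \sum_(0 <= i < K) ((2^-1 : R) ^+ i *: f i).
have PS K : P K.+1 = P K + (2^-1) ^+ K *: f K by rewrite /P big_nat_recr.
have P2 K : nrm (P K) <= 2 - 2 * (2^-1) ^+ K.
  elim: K => [|K IH]; first by rewrite /P big_geq // nrm0; lra.
  rewrite PS; apply: le_trans (nrmD _ _) _; rewrite nrmZ ger0_norm // exprS.
  by have [_ fK _] := fP K; have := ler_wpM2l (h0 K) fK; lra.
have [fs fsP] : exists fs : dnlat X, forall i, (2^-1) ^+ i *: f i [<=] fs.
  have [|fs fsP] := @dual_ulim R X P 2.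
    by move=> K; apply: le_trans (P2 K) _; have := h0 K; lra.
  exists fs => i; apply: ap_leP => x x0.
  apply: (fsP x _ i.+1).1 => n; elim: n => // n IH; rewrite ltnS leq_eqVlt => /predU1P[->|/IH].
    rewrite PS apDl lerDr; apply: ap_ge0 => //; apply: nsum_ge0 => j _; exact: nscale_ge0.
  rewrite PS apDl => h; have := ap_ge0 (nscale_ge0 (h0 n) (f0 n)) x0; lra.
have fs0 : 0 [<=] fs.
  by apply: nle_trans (fsP 0%N); rewrite expr0 scale1r.
pose v n := npos (f n - 4 ^+ n *: S n - (2^-1) ^+ n *: fs).
have v0 n : 0 [<=] v n by exact: npos_ge0.
have vf n : v n [<=] f n.
  apply: npos_least => //.
  apply: (nle_eq (nadd_ge0 (nscale_ge0 (q0 n) (S0 n)) (nscale_ge0 (h0 n) fs0))).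
  by vring (nV (dnlat X)).
have [N NP] := @half_pow_small R (ap phi fs) (e / 2) ltac:(lra).
have vdisj m n : (m < n)%N -> disj (v m) (v n).
  (* With this [c], [v n] lies below the positive and [v m] below the negative part of
     [f n - c f m]: the first because [c <= 4 ^ n], the second because [2^-m fs >= c^-1 f n]. *)
  move=> mn; apply: disj_sym; pose c : R := 2 ^+ (m + n).
  have c1 : 1 <= c by rewrite /c exprn_ege1 // ler1n.
  have c4 : c <= 4 ^+ n.
    have -> : (4 : R) = 2 ^+ 2 by rewrite expr2; lra.
    by rewrite -exprM; apply: ler_weXn2l; [rewrite ler1n|rewrite mul2n -addnn leq_add2r ltnW].
  apply: (@disjW _ _ _ _ (npos (f n - c *: f m)) (npos (- (f n - c *: f m)))) => //.
  - apply: npos_le.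
    have a1 := nle_scale (q0 n) (fS _ _ mn).
    have a2 := nle_scalel (f0 m) c4.
    have a3 := nscale_ge0 (h0 n) fs0.
    apply: (nle_eq (nle_addn (nle_addn a1 a2) a3)); vring (nV (dnlat X)).
  - have b1 : v m [<=] npos (f m - c^-1 *: f n).
      apply: npos_le; have a1 := nscale_ge0 (q0 m) (S0 m).
      have a2 := nle_scale (h0 m) (fsP n).
      have ec : (2^-1) ^+ m * (2^-1) ^+ n = c^-1 by rewrite -exprD exprVn.
      rewrite scalerA ec in a2.
      by apply: (nle_eq (nle_addn a1 a2)); vring (nV (dnlat X)).
    apply: nle_trans b1 _.
    have c0 : 0 < c by lra.
    apply: npos_least; first exact: npos_ge0.
    have b2 := nle_scale (ltW (_ : 0 < c^-1)) (npos_ge (- (f n - c *: f m))).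
    have {b2} := b2 ltac:(by rewrite invr_gt0) => b2.
    have b3 := nle_scalel (npos_ge0 (- (f n - c *: f m))) (_ : c^-1 <= 1).
    have {b3} := b3 ltac:(by rewrite invf_le1) => b3.
    apply: (nle_trans (c^-1 *: - (f n - c *: f m))).
      have -> : c^-1 *: - (f n - c *: f m) = (c^-1 * c) *: f m - c^-1 *: f n by vring (nV (dnlat X)).
      by rewrite mulVf ?lt0r_neq0 // scale1r; exact: nle_refl.
    by apply: nle_trans b2 _; apply: nle_trans b3 _; rewrite scale1r; exact: nle_refl.
  - exact: disj_pos_neg.
(* Starting at [N] keeps the correction [2^-k phi fs] at most [e / 2], so [phi] falls below [e] at
   [(f k - 4^k S k)^+], against the choice of [f k]. *)
have [|||n] := @phi_disj (fun n => v (N + n)%N) _ _ _ (e / 2) ltac:(lra).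
- by move=> n; exact: v0.
- by move=> n; apply: le_trans (nrm_pos_le (v0 _) (vf _)) _; have [] := fP (N + n)%N.
- by move=> m n mn; apply: vdisj; rewrite ltn_add2l.
- have := NP _ (leq_addr n N); set k := (N + n)%N => Nk.
  have [_ _ fe] := fP k.
  have : npos (f k - 4 ^+ k *: S k) [<=] v k + (2^-1) ^+ k *: fs.
    apply: npos_least; first by apply: nadd_ge0 => //; exact: nscale_ge0.
    by apply: (nle_eq (npos_ge (f k - 4 ^+ k *: S k - (2^-1) ^+ k *: fs))); rewrite /v; vring (nV (dnlat X)).
  by move=> /(ap_mono phi0); rewrite apD apZ; lra.
Qed.

End AlmostOrderBounded.

(** * Disjoint sequences in the dual of a reflexive lattice *)

Definition reflexive_nlat (R : realType) (X : nlat R) :=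
  forall phi : dnlat (dnlat X), exists x, forall f, ap phi f = ap f x.

Section ReflexiveDisjoint.
Variables (R : realType) (X : nlat R) (v : nat -> dnlat X).
Hypotheses (v0 : forall n, 0 [<=] v n) (v1 : forall n, nrm (v n) <= 1).
Hypothesis vdisj : forall m n, (m < n)%N -> disj (v m) (v n).

(* Finite combinations of the [v n] with [k <= n], paired with their total mass. *)
Inductive tail_cone (k : nat) : dnlat X -> R -> Prop :=
  | Tail0 : tail_cone k 0 0
  | TailS d t n (a : R) : tail_cone k d t -> (k <= n)%N -> 0 <= a ->
      tail_cone k (d + a *: v n) (t + a).

Lemma tail_coneD k d t d' t' : tail_cone k d t -> tail_cone k d' t' ->
  tail_cone k (d + d') (t + t').
Proof.
move=> h; elim=> [|d'' t'' n a _ IH kn a0]; first by rewrite !addr0.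
by rewrite !addrA; exact: TailS.
Qed.

Lemma tail_coneZ k d t (b : R) : 0 <= b -> tail_cone k d t -> tail_cone k (b *: d) (b * t).
Proof.
move=> b0; elim=> [|d' t' n a _ IH kn a0]; first by rewrite scaler0 mulr0; exact: Tail0.
by rewrite scalerDr mulrDr scalerA; apply: TailS => //; exact: mulr_ge0.
Qed.

Lemma tail_cone_ge0 k d t : tail_cone k d t -> 0 [<=] d /\ 0 <= t.
Proof.
elim=> [|d' t' n a _ [d0 t0] kn a0]; first by split=> //; exact: nle_refl.
by split; [apply: nadd_ge0 => //; exact: nscale_ge0|exact: addr_ge0].
Qed.

Lemma tail_cone_disj k d t w : 0 [<=] w -> tail_cone k d t ->
  (forall n, (k <= n)%N -> disj (v n) w) -> disj d w.
Proof.
move=> w0 h vw; elim: h => [|d' t' n a h IH kn a0].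
  by apply: nle_anti; [exact: nmeetl|apply: nmeet_ge0 => //; exact: nle_refl].
have [d0 _] := tail_cone_ge0 h.
by apply: disjD => //; [exact: nscale_ge0|apply: disjZ => //; exact: vw].
Qed.

(** Only finitely many [v n] occur in [d]; [M] exceeds their indices. *)
Lemma tail_cone_finite k d t : tail_cone k d t -> exists M, forall w, 0 [<=] w ->
  (forall n, (n < M)%N -> disj (v n) w) -> disj d w.
Proof.
elim=> [|d' t' n a h [M MP] kn a0].
  exists 0%N => w w0 _.
  by apply: nle_anti; [exact: nmeetl|apply: nmeet_ge0 => //; exact: nle_refl].
have [d0 _] := tail_cone_ge0 h.
exists (maxn M n.+1) => w w0 vw.
apply: disjD => //; first exact: nscale_ge0.
  by apply: MP => // m mM; apply: vw; rewrite leq_max mM.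
by apply: disjZ => //; apply: vw; rewrite leq_max ltnSn orbT.
Qed.

Lemma tail_cone_mass k d t x (e : R) : 0 [<=] x -> (forall n, e <= ap (v n) x) ->
  tail_cone k d t -> e * t <= ap d x.
Proof.
move=> x0 ve; elim=> [|d' t' n a _ IH kn a0]; first by rewrite mulr0 ap0l.
by rewrite apDl apZl; have := ler_wpM2l a0 (ve n); lra.
Qed.

Lemma sublin_abs x : 0 [<=] x -> sublin (fun w : dnlat X => ap (nabs w) x).
Proof.
move=> x0; split=> [u w|a w a0].
  by rewrite -apDl; apply: ap_le => //; exact: nabsD.
by rewrite nabsZ ger0_norm // apZl.
Qed.

(* Mazur: an ultrafilter limit [f] of [v] is approximated, in the seminorm
   [w |-> |w|(x)], by two combinations with disjoint supports. *)
Lemma reflexive_disjoint_null x (e : R) : reflexive_nlat X -> 0 [<=] x -> 0 < e ->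
  exists n, ap (v n) x < e.
Proof.
move=> Xrefl x0 e0; apply: contrapT => H.
have ve n : e <= ap (v n) x by rewrite leNgt; apply/negP => h; apply: H; exists n.
have [f fP] := dual_ulim v1.
have Ns := sublin_abs x0.
(* Otherwise Hahn-Banach yields [phi] below the seminorm with [phi (v n - f) >= e / 2] for all
   [n >= k]. By reflexivity [phi] is evaluation at some [y], but [f y] is a limit of the values of
   [v n] at [y]. *)
have approx k : exists d t, [/\ tail_cone k d t, 0 < t & ap (nabs (d - t *: f)) x < e / 2 * t].
  apply: contrapT => Hk.
  pose K w s := exists d t, [/\ tail_cone k d t, w = d - t *: f & s = e / 2 * t].
  have Kc : vcone K.
    split.
    - by exists 0, 0; split; [exact: Tail0|rewrite scale0r subr0|rewrite mulr0].
    - move=> _ _ _ _ [d [t [h -> ->]]] [d' [t' [h' -> ->]]].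
      exists (d + d'), (t + t'); split; [exact: tail_coneD| |by rewrite mulrDr].
      by vring (nV (dnlat X)).
    - move=> b _ _ b0 [d [t [h -> ->]]].
      exists (b *: d), (b * t); split; [exact: tail_coneZ| |by rewrite mulrCA].
      by vring (nV (dnlat X)).
  have [|phi [phil phiN phiK]] := hahn_banach_sandwich Ns Kc.
    move=> _ _ [d [t [h -> ->]]]; have [d0] := tail_cone_ge0 h.
    rewrite le_eqVlt => /predU1P[<-|t0].
      by rewrite mulr0; apply: ap_ge0.
    by rewrite leNgt; apply/negP => lt; apply: Hk; exists d, t.
  have phib : bfun phi.
    split=> //; exists (nrm x) => w.
    have Nw : ap (nabs w) x <= nrm x * nrm w.
      by have := apb_le (nabs w) x; rewrite nrm_nabs mulrC.
    have := phiN w; have := phiN (- w); rewrite nabsN linN // ler_norml => ? ?.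
    by apply/andP; split; lra.
  have [y yP] := Xrefl (mkdual phib).
  have hy n : (k <= n)%N -> ap f y + e / 2 <= ap (v n) y.
    move=> kn; have : K (v n - f) (e / 2).
      exists (v n), 1; split; [|by rewrite scale1r|by rewrite mulr1].
      by rewrite -[v n]scale1r -[_ *: v n]add0r -[1 in X in tail_cone _ _ X]add0r;
        apply: TailS => //; exact: Tail0.
    by move=> /phiK; rewrite -[phi _]/(ap (mkdual phib) _) yP apBl; lra.
  have := (fP y _ k).1 hy; lra.
have [d [t [h t0 ht]]] := approx 0%N.
have [M MP] := tail_cone_finite h.
(* The second combination starts past all indices of the first, hence is disjoint from it. *)
have [d' [t' [h' t'0 ht']]] := approx M.
have [d0 _] := tail_cone_ge0 h.
have [d'0 _] := tail_cone_ge0 h'.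
have dd : disj d d'.
  apply: MP => // n nM; apply: disj_sym; apply: (tail_cone_disj (v0 n) h') => m Mm.
  by apply: disj_sym; apply: vdisj; exact: leq_trans nM Mm.
pose c := t^-1 *: d; pose c' := t'^-1 *: d'.
have ti : 0 <= t^-1 by rewrite invr_ge0 ltW.
have ti' : 0 <= t'^-1 by rewrite invr_ge0 ltW.
have cc : disj c c'.
  apply: disjZ => //; first exact: nscale_ge0.
  by apply: disj_sym; apply: disjZ => //; exact: disj_sym.
have near (s : R) w : 0 < s -> ap (nabs (w - s *: f)) x < e / 2 * s ->
    ap (nabs (s^-1 *: w - f)) x < e / 2.
  move=> s0 hs; have -> : s^-1 *: w - f = s^-1 *: (w - s *: f).
    by rewrite scalerBr scalerA mulVf ?lt0r_neq0 // scale1r.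
  rewrite nabsZ apZl ger0_norm ?invr_ge0 1?ltW // mulrC ltr_pdivrMr //.
have a1 := near _ _ t0 ht; have a2 := near _ _ t'0 ht'.
have b1 := disj_abs_sub (nscale_ge0 ti d0) (nscale_ge0 ti' d'0) cc.
have b2 : nabs (c - c') [<=] nabs (c - f) + nabs (c' - f).
  have -> : c - c' = (c - f) + - (c' - f) by vring (nV (dnlat X)).
  by apply: nle_trans (nabsD _ _) _; rewrite nabsN; exact: nle_refl.
(* The contradiction is [e <= c x <= |c - f| x + |c' - f| x < e]. *)
have := ap_le (nle_trans _ b1 b2) x0; rewrite apDl apZl.
have := ler_wpM2l ti (tail_cone_mass x0 ve h).
rewrite mulrCA mulVf ?lt0r_neq0 // mulr1 => m1 m2.
have : ap (nabs (c - f)) x < e / 2 := a1.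
have : ap (nabs (c' - f)) x < e / 2 := a2.
move: m1 m2; clear; lra.
Qed.

End ReflexiveDisjoint.

Lemma reflexive_almost_order_bounded (R : realType) (X : nlat R) (x : X) (e : R) :
  reflexive_nlat X -> 0 [<=] x -> 0 < e -> exists u : dnlat X, 0 [<=] u /\
  forall f, 0 [<=] f -> nrm f <= 1 -> ap (npos (f - u)) x <= e.
Proof.
move=> Xrefl x0 e0; apply: (@almost_order_bounded R X (ev x)) => //.
  exact: ev_ge0.
move=> v v0 v1 vd d d0; exact: (@reflexive_disjoint_null R X v v0 v1 vd x d).
Qed.

(** * Approximating bidual elements *)

Section AbsoluteContinuity.
Variables (R : realType) (X : nlat R).
Hypothesis decreasing_weak_null : forall (chi : dnlat (dnlat X)) (g : nat -> dnlat X),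
  (forall n, 0 [<=] g n) -> (forall n, g n.+1 [<=] g n) ->
  (forall x, 0 [<=] x -> forall e : R, 0 < e -> exists n, ap (g n) x <= e) ->
  forall e : R, 0 < e -> exists n, ap chi (g n) < e.

(* Otherwise there are [f n] in [[0, u]] and [y n] in the unit ball with [f n (y n)]
   large but [f n (y k)] tiny for [k < n]; then the suprema of the tails of [f]
   decrease pointwise to some [g], but not weakly, as a cluster point of [y] shows. *)
Lemma interval_absolute_continuity (u : dnlat X) (e : R) : 0 [<=] u -> 0 < e ->
  exists x, exists d : R, [/\ 0 [<=] x, 0 < d & forall f, 0 [<=] f -> f [<=] u ->
    ap f x <= d -> nrm f <= e].
Proof.
move=> u0 e0; apply: contrapT => H.
have {}H (q : X * R) : exists f : dnlat X, 0 [<=] q.1 -> 0 < q.2 ->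
    [/\ 0 [<=] f, f [<=] u, ap f q.1 <= q.2 & e < nrm f].
  apply: contrapT => Hq; apply: H; exists q.1, q.2.
  have [q1|q1] := pselect (0 [<=] q.1); last by case: Hq; exists 0.
  have [q2|q2] := pselect (0 < q.2); last by case: Hq; exists 0.
  split=> // f f0 fu fq; rewrite leNgt; apply/negP => lt; apply: Hq.
  by exists f => _ _; split.
have [ch chP] := choice H.
have N (f : dnlat X) : exists y, 0 [<=] f -> e < nrm f ->
    [/\ 0 [<=] y, nrm y <= 1 & e < ap f y].
  have [[f0 fe]|Nf] := pselect (0 [<=] f /\ e < nrm f).
    by have [y yP] := nrm_dual_approx f0 fe; exists y.
  by exists 0 => f0 fe; case: Nf.
have [nch nchP] := choice N.
(* As [Z n] dominates every earlier [y k], smallness of [f n] at the single point [Z n] covers them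
   all. *)
pose Z := fix Z n := if n is m.+1 then Z m + nch (ch (Z m, (2^-1) ^+ m)) else 0.
pose f n := ch (Z n, (2^-1) ^+ n); pose y n := nch (f n).
have h0 n : 0 < (2^-1) ^+ n :> R by rewrite exprn_gt0 // invr_gt0.
have Z0 n : 0 [<=] Z n.
  elim: n => [|n IH]; first exact: nle_refl.
  have [a _ _ b] := chP (Z n, (2^-1) ^+ n) IH (h0 n).
  by apply: nadd_ge0 => //; have [] := nchP _ a b.
have fP n : [/\ 0 [<=] f n, f n [<=] u, ap (f n) (Z n) <= (2^-1) ^+ n & e < nrm (f n)].
  exact: (chP (Z n, _) (Z0 n) (h0 n)).
have f0 n : 0 [<=] f n by case: (fP n).
have yP n : [/\ 0 [<=] y n, nrm (y n) <= 1 & e < ap (f n) (y n)].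
  by have [a _ _ b] := fP n; exact: nchP.
have y0 n : 0 [<=] y n by case: (yP n).
have yZ k n : (k < n)%N -> y k [<=] Z n.
  elim: n => // n IH; rewrite ltnS leq_eqVlt => /predU1P[->|/IH kn].
    by apply: (nle_eq (Z0 n)); rewrite /= -/(f n) -/(y n); vring (nV X).
  by apply: (nle_eq (nle_addn kn (y0 n))); rewrite /= -/(f n) -/(y n); vring (nV X).
have fy k n : (k < n)%N -> ap (f n) (y k) <= (2^-1) ^+ n.
  by move=> kn; have [_ _ h _] := fP n; apply: le_trans h; apply: ap_mono => //; exact: yZ.
(* Tail suprema are cut off at [K]; the limit [g n] over [K] later replaces the infinite
   supremum. *)
pose J n := fix J K : dnlat X :=
  if K is k.+1 then (if (n <= k)%N then njoin (J k) (f k) else J k) else 0.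
have J0 n K : 0 [<=] J n K.
  elim: K => [|K IH] /=; first exact: nle_refl.
  by case: ifP => // _; exact: nle_trans IH (njoinl _ _).
have Ju n K : J n K [<=] u.
  elim: K => [|K IH] //=; case: ifP => // _; apply: njoin_least => //.
  by case: (fP K).
have fJ n m K : (n <= m)%N -> (m < K)%N -> f m [<=] J n K.
  move=> nm; elim: K => // K IH; rewrite ltnS leq_eqVlt => /predU1P[mK|/IH mK] /=.
    by rewrite -mK nm; exact: njoinr.
  by case: ifP => // _; exact: nle_trans mK (njoinl _ _).
have JS n K : J n.+1 K [<=] J n K.
  elim: K => [|K IH] /=; first exact: nle_refl.
  case: ltnP => nK; last first.
    by case: ifP => // _; exact: nle_trans IH (njoinl _ _).
  by rewrite (ltnW nK); apply: njoin_le2 => //; exact: nle_refl.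
have Jy n K k : (k < n)%N -> ap (J n K) (y k) <= 2 * (2^-1) ^+ n.
  move=> kn; have J00 j : (j <= n)%N -> J n j = 0.
    by elim: j => //= j IH jn; rewrite leqNgt jn /= IH // ltnW.
  (* A join of positive elements is below their sum, so a geometric series bounds the tail; the
     subtracted term is its exact remainder. *)
  suff h j : ap (J n (n + j)%N) (y k) <= 2 * (2^-1) ^+ n - 2 * (2^-1) ^+ (n + j).
    have [Kn|nK] := leqP K n; first by rewrite J00 // ap0l mulr_ge0 // ltW.
    by have := h (K - n)%N; rewrite subnKC ?(ltnW nK) //; have := h0 K; lra.
  elim: j => [|j IH]; first by rewrite addn0 J00 // ap0l; lra.
  rewrite addnS /= leq_addr.
  have : njoin (J n (n + j)%N) (f (n + j)%N) [<=] J n (n + j)%N + f (n + j)%N.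
    apply: njoin_least.
      by apply: (nle_eq (f0 (n + j)%N)); vring (nV (dnlat X)).
    by apply: (nle_eq (J0 n (n + j)%N)); vring (nV (dnlat X)).
  move=> /ap_le/(_ (y0 k)); rewrite apDl exprS.
  by have := fy k (n + j)%N (leq_trans kn (leq_addr _ _)); lra.
have JC n K : nrm (J n K) <= nrm u by exact: nrm_pos_le.
have [g gP] := choice (fun n => dual_ulim (JC n)).
have g0 n : 0 [<=] g n.
  by apply: ap_leP => x x0; apply: (gP n x _ 0%N).1 => K _; exact: ap_le.
have gu n : g n [<=] u.
  by apply: ap_leP => x x0; apply: (gP n x _ 0%N).2 => K _; exact: ap_le.
have fg n m : (n <= m)%N -> f m [<=] g n.
  by move=> nm; apply: ap_leP => x x0; apply: (gP n x _ m.+1).1 => K mK; apply: ap_le => //; exact: fJ.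
have Jg n K : J n K [<=] g n.
  apply: ap_leP => x x0; apply: (gP n x _ K).1 => K' KK'; apply: ap_le => //.
  elim: K' KK' => [|K' IH]; first by rewrite leqn0 => /eqP ->; exact: nle_refl.
  rewrite leq_eqVlt => /predU1P[->|]; first exact: nle_refl.
  rewrite ltnS => /IH KK' /=; case: ifP => // _; exact: nle_trans KK' (njoinl _ _).
have gS n : g n.+1 [<=] g n.
  apply: ap_leP => x x0; apply: (gP n.+1 x _ 0%N).2 => K _; apply: ap_le => //.
  exact: nle_trans (JS n K) (Jg n K).
have gy k n : (k < n)%N -> ap (g n) (y k) <= 2 * (2^-1) ^+ n.
  by move=> kn; apply: (gP n (y k) _ 0%N).2 => K _; exact: Jy.
have gmono m n : (m <= n)%N -> g n [<=] g m.
  elim: n => [|n IH]; first by rewrite leqn0 => /eqP ->; exact: nle_refl.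
  rewrite leq_eqVlt => /predU1P[->|]; first exact: nle_refl.
  by rewrite ltnS => /IH; exact: nle_trans.
have gC n : nrm (g n) <= nrm u by exact: nrm_pos_le.
(* [g] need not tend to [0] pointwise, but [g - G] does, and [G] is at most [0] at every [y k]. *)
have [G GP] := dual_ulim gC.
have Gg n : G [<=] g n.
  by apply: ap_leP => x x0; apply: (GP x _ n).2 => m nm; apply: ap_le => //; exact: gmono.
have Gy k : ap G (y k) <= 0.
  apply/ler_addgt0Pr => d d0; rewrite add0r.
  have [M MP] := half_pow_small 2 d0.
  apply: (GP _ _ (maxn M k.+1)).2 => n; rewrite geq_max => /andP[Mn kn].
  by apply: le_trans (gy _ _ kn) _; rewrite mulrC; exact: MP.
have yC n : nrm (ev (y n)) <= 1.
  by apply: le_trans (nrm_ev_le _) _; case: (yP n).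
have [chi chiP] := dual_ulim yC.
have [||x x0 d d0|n] := @decreasing_weak_null chi (fun n => g n - G) _ _ _ e e0.
- by move=> n; exact: nle_sub.
- by move=> n; apply: nle_add.
- apply: contrapT => Hn.
  have : ap G x + d <= ap G x.
    apply: (GP x _ 0%N).1 => n _; rewrite leNgt; apply/negP => lt; apply: Hn.
    by exists n; rewrite apBl; lra.
  by lra.
(* For [m >= n], [g n (y m) >= f m (y m) > e] while [G (y m) <= 0]; the bound passes to the cluster
   point [chi]. *)
- apply/negP; rewrite -leNgt; apply: (chiP _ _ n).1 => m nm; rewrite evE apBl.
  have := ap_le (fg _ _ nm) (y0 m); have := Gy m; have [_ _ h] := yP m; lra.
Qed.

End AbsoluteContinuity.

(** * Approximation inside an order interval *)

Section Interval.
Variables (R : realType) (X : nlat R) (x : X) (u : dnlat X) (psi : dnlat (dnlat X)).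
Hypotheses (x0 : 0 [<=] x) (u0 : 0 [<=] u) (psi0 : 0 [<=] psi) (psix : psi [<=] ev x).
Implicit Types (y z : X) (T : seq R) (F : seq (dnlat X)).

(* With [x] and [y] functions, the supremum of [2ty - t^2x] over all [t] is [y^2/x];
   [energy] is then the integral of [y^2/x] against [u], a uniformly convex functional. *)
Definition parab T y := foldr (fun t j => njoin ((2 * t) *: y - t ^+ 2 *: x) j) 0 T.

Definition energy y := sup [set ap u (parab T y) | T in [set: seq R]].

Lemma parab_mem T y t : t \in T -> (2 * t) *: y - t ^+ 2 *: x [<=] parab T y.
Proof.
elim: T => // t' T IH; rewrite inE => /predU1P[->|/IH h] /=; first exact: njoinl.
exact: nle_trans h (njoinr _ _).
Qed.

Lemma parab_least T y z : 0 [<=] z ->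
  (forall t, t \in T -> (2 * t) *: y - t ^+ 2 *: x [<=] z) -> parab T y [<=] z.
Proof.
move=> z0; elim: T => //= t T IH h; apply: njoin_least.
  by apply: h; rewrite inE eqxx.
by apply: IH => s sT; apply: h; rewrite inE sT orbT.
Qed.

Lemma parab_le T y : 0 [<=] y -> y [<=] x -> parab T y [<=] x.
Proof.
move=> y0 yx; apply: parab_least => // t _.
have h (a : R) z : 0 [<=] z -> z [<=] x -> a *: z [<=] `|a| *: x.
  move=> z0 zx; apply: nle_trans (nle_scale (normr_ge0 a) zx).
  by apply: nle_scalel => //; exact: ler_norm.
have h1 := h (2 * t) y y0 yx.
have h2 : `|2 * t| *: x [<=] (1 + t ^+ 2) *: x.
  apply: nle_scalel => //; have := sqr_ge0 (1 + t); have := sqr_ge0 (1 - t).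
  by rewrite ler_norml => ? ?; apply/andP; split; lra.
by apply: (nle_eq (nle_addn h1 h2)); vring (nV X).
Qed.

Lemma energy_ub y r : 0 [<=] y -> y [<=] x ->
  [set ap u (parab T y) | T in [set: seq R]] r -> r <= ap u x.
Proof. by move=> y0 yx [T _ <-]; apply: ap_mono => //; exact: parab_le. Qed.

Lemma energy_ge T y : 0 [<=] y -> y [<=] x -> ap u (parab T y) <= energy y.
Proof.
by move=> y0 yx; apply: ge_sup_mem; [move=> r; exact: energy_ub y0 yx|exists T].
Qed.

Lemma energy_ge0 y : 0 [<=] y -> y [<=] x -> 0 <= energy y.
Proof. by move=> y0 yx; have := energy_ge [::] y0 yx; rewrite /= ap0. Qed.

Lemma energy_le y : 0 [<=] y -> y [<=] x -> energy y <= ap u x.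
Proof.
move=> y0 yx; apply: (@sup_bounded_le _ _ _ (ap u (parab [::] y))); first by exists [::].
by move=> r; exact: energy_ub.
Qed.

(** Adding the term for [y] at [t + s / 2] and the one for [y'] at [t - s / 2] gives twice the
    midpoint term at [t], plus [s (y - y') - s ^ 2 / 2 x]. Exchanging the shifts flips the sign of
    [y - y'], whence the absolute value. *)
Lemma energy_convex y y' (s : R) : 0 <= s ->
  0 [<=] y -> y [<=] x -> 0 [<=] y' -> y' [<=] x ->
  2 * energy (2^-1 *: (y + y')) + s * ap u (nabs (y - y')) - s ^+ 2 / 2 * ap u x
    <= energy y + energy y'.
Proof.
move=> s0 y0 yx y'0 y'x; set m := 2^-1 *: (y + y').
have i0 : 0 <= 2^-1 :> R by lra.
have m0 : 0 [<=] m by apply: nscale_ge0 => //; exact: nadd_ge0.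
have mx : m [<=] x.
  by apply: (nle_eq (nle_scale i0 (nle_addn yx y'x))); rewrite /m; vring (nV X).
suff h T : 2 * ap u (parab T m) <=
    energy y + energy y' - s * ap u (nabs (y - y')) + s ^+ 2 / 2 * ap u x.
  suff : energy m <=
      2^-1 * (energy y + energy y' - s * ap u (nabs (y - y')) + s ^+ 2 / 2 * ap u x) by lra.
  apply: (@sup_bounded_le _ _ _ (ap u (parab [::] m))); first by exists [::].
  by move=> _ [T _ <-]; have := h T; lra.
(* The parameter [0] is adjoined because its term, the zero vector, yields [0 <= W]. *)
pose T' := [seq t + s / 2 | t <- 0 :: T] ++ [seq t - s / 2 | t <- 0 :: T].
pose W := parab T' y + parab T' y' - s *: nabs (y - y') + (s ^+ 2 / 2) *: x.
have key t : t \in 0 :: T -> 2 *: ((2 * t) *: m - t ^+ 2 *: x) [<=] W.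
  move=> tT.
  have tp : t + s / 2 \in T' by rewrite mem_cat; apply/orP; left; apply/mapP; exists t.
  have tm : t - s / 2 \in T' by rewrite mem_cat; apply/orP; right; apply/mapP; exists t.
  pose D := parab T' y + parab T' y' + (s ^+ 2 / 2) *: x - 2 *: ((2 * t) *: m - t ^+ 2 *: x).
  have h : nabs (s *: (y - y')) [<=] D.
    apply: nabs_least.
      apply: (nle_eq (nle_addn (parab_mem y tp) (parab_mem y' tm))).
      by rewrite /D /m; vring (nV X).
    apply: (nle_eq (nle_addn (parab_mem y tm) (parab_mem y' tp))).
    by rewrite /D /m; vring (nV X).
  rewrite nabsZ ger0_norm // in h.
  by apply: (nle_eq h); rewrite /W /D; vring (nV X).
have W0 : 0 [<=] W.
  apply: (nle_eq (key 0 _)); first by rewrite inE eqxx.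
  by vring (nV X).
have hT : parab T m [<=] 2^-1 *: W.
  apply: parab_least; first exact: nscale_ge0.
  move=> t tT; have kt : t \in 0 :: T by rewrite inE tT orbT.
  by apply: (nle_eq (nle_scale i0 (key t kt))); vring (nV X).
have := ap_mono u0 hT; rewrite /W !(apD, apZ, apN).
have := energy_ge T' y0 yx; have := energy_ge T' y'0 y'x; lra.
Qed.

Definition near_psi F (d : R) y :=
  [/\ 0 [<=] y, y [<=] x & forall f, f \in F -> `|ap f y - ap psi f| <= d].

(** A Goldstine theorem for [[0, x]]. Separation in R^n would give a combination [f] of [F] with
    [f y >= psi f + d] on the whole interval, whereas Riesz-Kantorovich and [psi <= ev x] provide a
    [y] with [f y < psi f + d]. *)
Lemma near_psi_nonempty F (d : R) : 0 < d -> exists y, near_psi F d y.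
Proof.
move=> d0; apply: contrapT => H.
pose n := size F; pose V : lmodType R := 'rV[R]_n.
pose fi (i : 'I_n) : dnlat X := nth 0 F i.
pose N (w : V) := \sum_i `|w 0 i|.
have Ns : sublin N.
  split=> [w w'|a w a0].
    by rewrite /N -big_split; apply: ler_sum => i _; rewrite mxE ler_normD.
  by rewrite /N mulr_sumr; apply: eq_bigr => i _; rewrite mxE normrM ger0_norm.
pose vec z (a : R) : V := \row_i (ap (fi i) z - a * ap psi (fi i)).
(* The factor [a] homogenises the interval, making a cone of the differences between its points and
   [psi]. *)
pose K (w : V) t := exists z (a : R), [/\ 0 <= a, 0 [<=] z, z [<=] a *: x, w = vec z a & t = a * d].
have Kc : vcone K.
  split.
  - exists 0, 0; split=> //; rewrite ?scale0r ?mul0r //; try exact: nle_refl.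
    by apply/rowP => i; rewrite !mxE ap0 mul0r subr0.
  - move=> _ _ _ _ [z [a [a0 z0 za -> ->]]] [z' [a' [a'0 z'0 za' -> ->]]].
    exists (z + z'), (a + a'); split.
    + exact: addr_ge0.
    + exact: nadd_ge0.
    + by rewrite scalerDl; exact: nle_addn.
    + by apply/rowP => i; rewrite !mxE apD; ring.
    + by rewrite mulrDl.
  - move=> b _ _ b0 [z [a [a0 z0 za -> ->]]].
    exists (b *: z), (b * a); split.
    + exact: mulr_ge0.
    + exact: nscale_ge0.
    + by rewrite -scalerA; exact: nle_scale.
    + by apply/rowP => i; rewrite !mxE apZ; ring.
    + by rewrite mulrA.
have [|alpha [al aN aK]] := hahn_banach_sandwich Ns Kc.
  move=> _ _ [z [a [a0 z0 za -> ->]]].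
  move: a0; rewrite le_eqVlt => /predU1P[<-|a0].
    by rewrite mul0r; apply: sumr_ge0.
  have ai : 0 <= a^-1 by rewrite invr_ge0 ltW.
  have an0 : a != 0 by rewrite lt0r_neq0.
  have [i hi] : exists i, d < `|ap (fi i) (a^-1 *: z) - ap psi (fi i)|.
    apply: contrapT => Hi; apply: H; exists (a^-1 *: z); split.
    - exact: nscale_ge0.
    - by have := nle_scale ai za; rewrite scalerA mulVf // scale1r.
    - move=> f fF; rewrite leNgt; apply/negP => lt; apply: Hi.
      have fn : (index f F < n)%N by rewrite index_mem.
      by exists (Ordinal fn); rewrite /fi /= nth_index.
  rewrite /N (bigD1 i) //= -[leLHS]addr0; apply: lerD; last exact: sumr_ge0.
  rewrite mxE; have -> : ap (fi i) z - a * ap psi (fi i) =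
      a * (ap (fi i) (a^-1 *: z) - ap psi (fi i)).
    by rewrite apZ mulrBr mulrA mulfV // mul1r.
  by rewrite normrM gtr0_norm // ler_wpM2l // ltW.
have a0 := lin0 al.
have alphaE w : alpha w = \sum_i w 0 i * alpha (delta_mx 0 i).
  rewrite {1}(row_sum_delta w); elim/big_rec2: _ => // i s w' _ <-.
  by rewrite al.
pose f : dnlat X := \sum_i alpha (delta_mx 0 i) *: fi i.
have apf (chi : dnlat (dnlat X)) : ap chi f = \sum_i alpha (delta_mx 0 i) * ap chi (fi i).
  rewrite /f; elim/big_rec2: _ => [|i s w' _ <-]; first exact: ap0.
  by rewrite apD apZ.
have fgt y : 0 [<=] y -> y [<=] x -> d <= ap f y - ap psi f.
  move=> y0 yx; have : K (vec y 1) d.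
    by exists y, 1; split=> //; rewrite ?scale1r ?mul1r.
  move=> /aK; rewrite alphaE -(evE y f) !apf -sumrB.
  suff -> : \sum_i vec y 1 0 i * alpha (delta_mx 0 i) =
    \sum_i (alpha (delta_mx 0 i) * ap (ev y) (fi i) - alpha (delta_mx 0 i) * ap psi (fi i)) by [].
  by apply: eq_bigr => i _; rewrite mxE evE; ring.
have [y [y0 yx hy]] := ap_pos_approx (- f) d0 x0.
have h1 : ap psi (- f) <= ap psi (npos (- f)) by exact: ap_mono.
have h2 : ap psi (npos (- f)) <= ap (npos (- f)) x by exact: (ap_le psix).
have := fgt y y0 yx; move: hy h1 h2; rewrite apNl apN; lra.
Qed.

Lemma near_psi_mid F (d : R) y y' : near_psi F d y -> near_psi F d y' ->
  near_psi F d (2^-1 *: (y + y')).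
Proof.
move=> [y0 yx yF] [y'0 y'x y'F]; have i0 : 0 <= 2^-1 :> R by lra.
split.
- by apply: nscale_ge0 => //; exact: nadd_ge0.
- by apply: (nle_eq (nle_scale i0 (nle_addn yx y'x))); vring (nV X).
- move=> f fF; have := yF f fF; have := y'F f fF.
  rewrite !ler_norml apZ apD => /andP[? ?] /andP[? ?]; apply/andP; split; lra.
Qed.

Lemma near_psi_sub F F' (d d' : R) y : {subset F' <= F} -> d <= d' ->
  near_psi F d y -> near_psi F' d' y.
Proof.
move=> FF dd [y0 yx h]; split=> // f /FF fF; exact: le_trans (h f fF) dd.
Qed.

(* Near-minimisers of [energy] over the sets [near_psi F d] form a Cauchy family. *)
Lemma interval_approximation (e : R) : 0 < e ->
  (forall f, 0 [<=] f -> nrm f <= 1 -> ap (npos (f - u)) x <= e) ->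
  exists y, forall f, nrm f <= 1 -> `|ap psi f - ap f y| <= 3 * e.
Proof.
move=> e0 hu.
(* [M = sup A] is the limit of the infima of [energy] over shrinking neighbourhoods of [psi]. *)
pose A := [set r | exists F, exists d : R, 0 < d /\ forall y, near_psi F d y -> r <= energy y].
have AM r : A r -> r <= ap u x.
  move=> [F [d [d0 h]]]; have [y yF] := near_psi_nonempty F d0.
  by apply: le_trans (h y yF) _; have [y0 yx _] := yF; exact: energy_le.
have A0 : A 0.
  by exists [::], 1; split=> // y [y0 yx _]; exact: energy_ge0.
pose M := sup A.
have ux0 : 0 <= ap u x by exact: ap_ge0.
(* [s] and [eta] are such that [4 eta + s ^ 2 / 2 * u x <= s e], which convexity turns into
   [u |y - y'| <= e]. *)
pose s := e / (ap u x + 1).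
have s0 : 0 < s by rewrite divr_gt0 //; lra.
have su : s * ap u x <= e by rewrite /s mulrAC ler_pdivrMr; nra.
pose eta := s * e / 8.
have eta0 : 0 < eta by rewrite /eta; nra.
have [r [F0 [d0 [d00 h0]]] hr] := sup_near eta0 AM A0.
have low y : near_psi F0 d0 y -> M - eta < energy y.
  by move=> /h0; apply: lt_le_trans.
have near_min F (d : R) : 0 < d -> exists2 y, near_psi F d y & energy y < M + eta.
  move=> dp; apply: contrapT => Hn.
  have : M + eta <= M.
    apply: (ge_sup_mem AM); exists F, d; split=> // y yF.
    by rewrite leNgt; apply/negP => lt; apply: Hn; exists y.
  by lra.
(* [y] is fixed before [f]; the second near-minimiser [y'] may depend on [f] and is close to [psi]
   there. *)
have [y yF ye] := near_min F0 d0 d00; exists y => f f1.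
pose d1 := Num.min d0 e.
have d10 : 0 < d1 by rewrite lt_min d00.
have [y' y'F y'e] := near_min (f :: F0) d1 d10.
have y'F0 : near_psi F0 d0 y'.
  apply: near_psi_sub y'F; last by rewrite ge_min lexx.
  by move=> g gF; rewrite inE gF orbT.
have mid := low _ (near_psi_mid yF y'F0).
have [y0 yx _] := yF; have [y'0 y'x y'f] := y'F.
have := energy_convex (ltW s0) y0 yx y'0 y'x.
set z := nabs (y - y'); set E := energy (2^-1 *: _) in mid *.
move=> conv.
have zu : ap u z <= e.
  have : s * ap u z <= s * e.
    have s2 : s ^+ 2 / 2 * ap u x <= s * e / 2 by nra.
    move: conv mid ye y'e s2; rewrite /eta; lra.
  by rewrite ler_pM2l.
have zx : z [<=] x by exact: nabs_le_sub.
have fz : `|ap f (y - y')| <= ap (nabs f) z by exact: ap_abs.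
have fz2 : ap (nabs f) z <= ap u z + ap (npos (nabs f - u)) z.
  rewrite -apDl; apply: ap_le; last exact: nabs_ge0.
  by apply: (nle_eq (npos_ge (nabs f - u))); vring (nV (dnlat X)).
have fz3 : ap (npos (nabs f - u)) z <= ap (npos (nabs f - u)) x by exact: ap_mono.
have fz4 : ap (npos (nabs f - u)) x <= e by apply: hu => //; rewrite nrm_nabs.
have fy' : `|ap f y' - ap psi f| <= e.
  apply: le_trans (y'f f _) _; first by rewrite inE eqxx.
  by rewrite /d1 ge_min lexx orbT.
have -> : ap psi f - ap f y = - (ap f (y - y') + (ap f y' - ap psi f)) by rewrite apB; ring.
rewrite normrN; apply: le_trans (ler_normD _ _) _.
move: fz fz2 fz3 fz4 fy' zu; lra.
Qed.

End Interval.

(** * Norm approximation of bidual elements *)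

Section BidualApproximation.
Variables (R : realType) (X : nlat R).
Hypothesis decreasing_weak_null : forall (chi : dnlat (dnlat X)) (g : nat -> dnlat X),
  (forall n, 0 [<=] g n) -> (forall n, g n.+1 [<=] g n) ->
  (forall x, 0 [<=] x -> forall e : R, 0 < e -> exists n, ap (g n) x <= e) ->
  forall e : R, 0 < e -> exists n, ap chi (g n) < e.
Hypothesis disjoint_weak_null : forall (phi : dnlat (dnlat X)) (v : nat -> dnlat X),
  (forall n, 0 [<=] v n) -> (forall n, nrm (v n) <= 1) ->
  (forall m n, (m < n)%N -> disj (v m) (v n)) ->
  forall e : R, 0 < e -> exists n, ap phi (v n) < e.

Lemma positive_bidual_approximation (phi : dnlat (dnlat X)) (e : R) : 0 [<=] phi -> 0 < e ->
  exists y, forall f, nrm f <= 1 -> `|ap phi f - ap f y| <= e.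
Proof.
(* Two shares of [e / 5] go to [phi - psi] and three to the approximation of [psi]. *)
move=> phi0 e0; pose b := e / 5; have b0 : 0 < b by rewrite /b; lra.
have [u [u0 hu]] := almost_order_bounded phi0 (disjoint_weak_null phi) b0.
pose c := b / (nrm phi + 1).
have p0 : 0 <= nrm phi by exact: nrm_ge0.
have c0 : 0 < c by rewrite divr_gt0 //; lra.
have pc : nrm phi * c <= b by rewrite /c mulrA ler_pdivrMr; nra.
have [x [d [x0 d0 hx]]] := interval_absolute_continuity decreasing_weak_null u0 c0.
(* With this [t], [g x > d] forces [t g x >= nrm phi >= phi g] for positive [g] in the unit ball. *)
pose t := nrm phi / d; have t0 : 0 <= t by rewrite divr_ge0 // ltW.
have td : t * d = nrm phi by rewrite /t divfK // lt0r_neq0.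
have tx0 : 0 [<=] t *: x by exact: nscale_ge0.
pose psi := nmeet phi (ev (t *: x)).
have psi0 : 0 [<=] psi by apply: nmeet_ge0 => //; exact: ev_ge0.
have [u' [u'0 hu']] := almost_order_bounded (ev_ge0 tx0) (disjoint_weak_null (ev (t *: x))) b0.
have [y hy] := interval_approximation tx0 u'0 psi0 (nmeetr phi (ev (t *: x))) b0 hu'.
exists y => f f1.
(* [phi - psi] is the positive part of [phi - ev (t *: x)], so its value at [|f|] is a supremum over
   [g] in [[0, |f|]]. If [g x <= d], then [g /\ u] is small in norm and [phi] is small at
   [(g - u)^+]. *)
have rest : `|ap (phi - psi) f| <= 2 * b.
  rewrite -nsub_pos; apply: le_trans (ap_abs _ _) _.
  rewrite (nabs_id (npos_ge0 _)); apply: ap_pos_le => // g g0 gf.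
  have g1 : nrm g <= 1 by apply: le_trans (nrm_pos_le g0 gf) _; rewrite nrm_nabs.
  rewrite apBl evE apZ; have [gd|dg] := leP (ap g x) d.
    have gx0 : 0 <= ap g x by exact: ap_ge0.
    have m0 : 0 [<=] nmeet g u by exact: nmeet_ge0.
    have mc : nrm (nmeet g u) <= c.
      apply: hx => //; first exact: nmeetr.
      by apply: le_trans gd; apply: ap_le => //; exact: nmeetl.
    have h1 := apb_le phi (nmeet g u).
    have h2 := ler_wpM2l p0 mc.
    have h3 := hu g g0 g1.
    have h4 : ap phi g = ap phi (nmeet g u) + ap phi (npos (g - u)).
      by rewrite -apD nsub_pos; congr ap; vring (nV (dnlat X)).
    have h5 := mulr_ge0 t0 gx0.
    move: h1 h2 h3 h4 h5 pc b0; lra.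
  have h1 := apb_le phi g; have h2 := ler_wpM2l p0 g1.
  have h3 := ler_wpM2l t0 (ltW dg); move: h1 h2 h3 td b0; lra.
have -> : ap phi f - ap f y = ap (phi - psi) f + (ap psi f - ap f y) by rewrite apBl; ring.
apply: le_trans (ler_normD _ _) _.
by have := hy f f1; move: rest; rewrite /b; lra.
Qed.

Lemma bidual_approximation (phi : dnlat (dnlat X)) (e : R) : 0 < e ->
  exists y, forall f, nrm f <= 1 -> `|ap phi f - ap f y| <= e.
Proof.
move=> e0; have e2 : 0 < e / 2 by lra.
have [y hy] := positive_bidual_approximation (npos_ge0 phi) e2.
have [z hz] := positive_bidual_approximation (npos_ge0 (- phi)) e2.
exists (y - z) => f f1; have hy1 := hy f f1; have hz1 := hz f f1.
have -> : ap phi f - ap f (y - z) =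
    (ap (npos phi) f - ap f y) - (ap (npos (- phi)) f - ap f z).
  by rewrite {1}(nposB phi) apBl apB; ring.
apply: le_trans (ler_normB _ _) _; move: hy1 hz1; lra.
Qed.

End BidualApproximation.

(** * Banach lattices *)

Lemma cvgn0P (R : realType) (h : nat -> R) :
  h n @[n --> \oo] --> (0 : R) <->
  (forall e : R, 0 < e -> exists N, forall n, (N <= n)%N -> `|h n| <= e).
Proof.
split=> [/cvgr0Pnorm_le hc e e0|hc].
  by have [N _ NP] := hc _ e0; exists N => n Nn; exact: NP.
apply/cvgr0Pnorm_le => e e0; have [N NP] := hc _ e0.
by exists N => // n /= Nn; exact: NP.
Qed.

Section BanachLattice.
Variables (R : realType) (E : completeNormedModType R) (L : banach_lattice E).

Definition blat : nlat R :=
  @Nlat R E (ble L) (bjoin L) (fun x => `|x|) (ble_refl L) (@ble_anti _ _ L)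
    (fun y x z => @ble_trans _ _ L x y z) (@ble_add _ _ L) (@ble_scale _ _ L)
    (@bjoin_ubl _ _ L) (@bjoin_ubr _ _ L) (@bjoin_least _ _ L)
    (@ler_normD _ _) (@normrZ _ _) (@blattice_norm _ _ L).

Lemma in_dual_bfun (f : E -> R) : in_dual f <-> @bfun R blat f.
Proof.
split=> [[fl fc]|[fl [C fC]]]; split=> //.
- have f0 : f 0 = 0 := lin0 fl.
  have fZ (a : R) x : f (a *: x) = a * f x by have := fl a x 0; rewrite addr0 f0 addr0.
  have := fc 0; rewrite /continuous_at f0 => /cvgr0Pnorm_le/(_ 1 ltr01).
  rewrite -nbhs_nearE => /nbhs_ballP[d /= d0 hd].
  exists (2 / d) => x; have [->|xn0] := eqVneq x 0; first by rewrite f0 nrm0 mulr0 normr0.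
  have xp : 0 < `|x| by rewrite normr_gt0.
  (* Rescaling [x] to norm [d / 2] puts it strictly inside the ball. *)
  pose a := d / 2 / `|x|.
  have a0 : 0 < a by rewrite !divr_gt0.
  have := hd (a *: x); rewrite -ball_normE /= sub0r normrN normrZ gtr0_norm //.
  rewrite /a divfK ?normr_eq0 // => /(_ ltac:(lra)).
  rewrite -/a fZ normrM gtr0_norm // => h.
  have -> : 2 / d * @nrm R blat x = a^-1.
    by rewrite /a !invfM !invrK -[@nrm R blat x]/(`|x|); ring.
  by rewrite -[leRHS]mul1r ler_pdivlMr // mulrC.
- move=> x; apply/cvgrPdist_le => e e0.
  have fB y : f x - f y = f (x - y).
    by have := fl (-1) y x; rewrite scaleN1r mulN1r [- y + x]addrC => ->; rewrite addrC.
  have C1 : 0 < `|C| + 1 by rewrite ltr_wpDl.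
  have d0 : 0 < e / (`|C| + 1) by rewrite divr_gt0.
  near=> y; rewrite fB; apply: le_trans (fC _) _.
  have xy : `|x - y| <= e / (`|C| + 1).
    near: y; apply/nbhs_ballP; exists (e / (`|C| + 1)) => // y.
    by rewrite -ball_normE /= => /ltW.
  have : C * `|x - y| <= (`|C| + 1) * `|x - y|.
    by rewrite ler_wpM2r //; have := ler_norm C; lra.
  have := ler_wpM2l (ltW C1) xy; rewrite mulrCA mulfV ?lt0r_neq0 // mulr1 => h1 h2.
  exact: le_trans h2 h1.
Unshelve. all: by end_near.
Qed.

Lemma in_dual_ap (f : dnlat blat) : in_dual (ap f).
Proof. by apply/in_dual_bfun; exact: dualP. Qed.

Definition to_dual (f : E -> R) (fd : in_dual f) : dnlat blat :=
  mkdual ((in_dual_bfun f).1 fd).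

Lemma in_dual_ex (f : E -> R) : in_dual f -> exists F : dnlat blat, f = ap F.
Proof. by move=> fd; exists (to_dual fd). Qed.

Lemma nrm_dualE (f : dnlat blat) : nrm f = dual_norm (ap f).
Proof. by []. Qed.

Lemma to_bidual (phi : (E -> R) -> R) : in_bidual phi ->
  exists chi : dnlat (dnlat blat), forall f, ap chi f = phi (ap f).
Proof.
move=> [phil [C phiC]].
have pb : bfun (fun f : dnlat blat => phi (ap f)).
  split=> [a f g|]; first by rewrite -phil //; exact: in_dual_ap.
  by exists C => f; apply: phiC; exact: in_dual_ap.
by exists (mkdual pb).
Qed.

(** Elements of the bidual take arbitrary functions as arguments; outside E' the default [0] is
    returned, which [in_bidual] never inspects. *)
Definition of_bidual (chi : dnlat (dnlat blat)) (f : E -> R) : R :=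
  if pselect (in_dual f) is left fd then ap chi (to_dual fd) else 0.

Lemma of_bidualE chi (f : dnlat blat) : of_bidual chi (ap f) = ap chi f.
Proof.
rewrite /of_bidual; case: pselect => [fd|]; last by case; exact: in_dual_ap.
by congr ap; apply: dual_eq.
Qed.

Lemma in_bidual_of chi : in_bidual (of_bidual chi).
Proof.
split=> [a f g /in_dual_ex[F ->] /in_dual_ex[G ->]|].
  rewrite (_ : (fun x => _) = ap (a *: F + G)) // !of_bidualE.
  by rewrite apD apZ.
by exists (nrm chi) => f /in_dual_ex[F ->]; rewrite of_bidualE; exact: apb.
Qed.

Lemma reflexive_spaceE : reflexive_space E <-> reflexive_nlat blat.
Proof.
split=> Er.
- move=> chi; have [x xP] := Er _ (in_bidual_of chi).
  by exists x => f; rewrite -of_bidualE xP //; exact: in_dual_ap.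
- move=> phi /to_bidual[chi chiP]; have [x xP] := Er chi.
  by exists x => f /in_dual_ex[F ->]; rewrite -chiP xP.
Qed.

Lemma is_dual_sup_abs (f : dnlat blat) :
  is_dual_sup L (ap f) (fun x => - ap f x) (ap (nabs f)).
Proof.
split; [exact: in_dual_ap|exact: (nabs_gel f)|exact: (nabs_ger f)|].
move=> k /in_dual_ex[K ->] fK gK; exact: (@nabs_least _ _ f K).
Qed.

Lemma is_dual_inf_meet (f g : dnlat blat) : is_dual_inf L (ap f) (ap g) (ap (nmeet f g)).
Proof.
split; [exact: in_dual_ap|exact: (nmeetl f g)|exact: (nmeetr f g)|].
move=> k /in_dual_ex[K ->] fK gK; exact: (@nmeet_greatest _ _ f g K).
Qed.

Lemma reflexive_unbounded_grothendieck : reflexive_space E -> unbounded_grothendieck L.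
Proof.
move=> Er; have Er' := Er; move/reflexive_spaceE in Er'.
move=> xs xsd [C xsC] xs0 phi phib.
have [z zP] := Er _ phib.
have [f fE] := choice (fun n => in_dual_ex (xsd n)).
apply/cvgn0P => e e0.
pose x : blat := nabs (z : blat); have x0 : 0 [<=] x by exact: nabs_ge0.
(* The bound for [u] concerns the unit ball, so the sequence is divided by [D] and [u] multiplied by
   it; the added [1] keeps [D] positive. *)
pose D := `|C| + 1; have D0 : 0 < D by rewrite /D ltr_wpDl.
have e2 : 0 < e / 2 / D by rewrite !divr_gt0.
have [u [u0 hu]] := reflexive_almost_order_bounded Er' x0 e2.
have Du0 : 0 [<=] D *: u by apply: nscale_ge0 => //; exact: ltW.
have := xs0 (ap (D *: u)) (in_dual_ap _) Du0 (fun n => ap (nabs (f n)))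
  (fun n => ap (nmeet (nabs (f n)) (D *: u))).
move=> /(_ (fun n => _)) /(_ (fun n => is_dual_inf_meet _ _)) h.
have {h} /h/(_ x)/cvgn0P/(_ (e / 2)) : forall n,
    is_dual_sup L (xs n) (fun x => - xs n x) (ap (nabs (f n))).
  by move=> n; rewrite fE; exact: is_dual_sup_abs.
case; first by lra.
move=> N NP; exists N => n Nn; rewrite zP // fE.
have h1 := NP n Nn.
have h2 : `|ap (f n) z| <= ap (nabs (f n)) x by exact: ap_abs.
have h3 : ap (nabs (f n)) x = ap (nmeet (nabs (f n)) (D *: u)) x +
    ap (npos (nabs (f n) - D *: u)) x by rewrite nsub_pos apBl; ring.
have Di : 0 <= D^-1 by rewrite invr_ge0 ltW.
have h4 : ap (npos (D^-1 *: nabs (f n) - u)) x <= e / 2 / D.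
  apply: hu; first exact: nscale_ge0.
  rewrite nrmZ nrm_nabs ger0_norm // mulrC ler_pdivrMr // mul1r.
  apply: le_trans (_ : C <= D); first by rewrite nrm_dualE -fE.
  by rewrite /D; have := ler_norm C; lra.
have h5 : npos (nabs (f n) - D *: u) = D *: npos (D^-1 *: nabs (f n) - u).
  rewrite /npos -njoinZ ?ltW // scaler0 scalerBr scalerA mulfV ?lt0r_neq0 //.
  by rewrite scale1r.
have h6 : ap (npos (nabs (f n) - D *: u)) x <= e / 2.
  by rewrite h5 apZl mulrC -ler_pdivlMr.
have h7 := le_trans (ler_norm _) h1.
apply: le_trans h2 _; rewrite h3; lra.
Qed.

(** * From the unbounded Grothendieck property to reflexivity *)

Section Converse.
Hypothesis EG : unbounded_grothendieck L.

Lemma unbounded_grothendieck_null (g : nat -> dnlat blat) (C : R) (chi : dnlat (dnlat blat)) :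
  (forall n, 0 [<=] g n) -> (forall n, nrm (g n) <= C) ->
  (forall u : dnlat blat, 0 [<=] u -> forall x, 0 [<=] x -> forall e : R, 0 < e ->
    exists N, forall n, (N <= n)%N -> ap (nmeet (g n) u) x <= e) ->
  forall e : R, 0 < e -> exists n, ap chi (g n) < e.
Proof.
move=> g0 gC gu e e0.
have : dual_weak_null (fun n => ap (g n)).
  apply: (EG (fun n => in_dual_ap (g n))); first by exists C => n; rewrite -nrm_dualE.
  (* [a] and [b] are known only through the universal properties of suprema and infima; these give
     [0 <= b n <= g n /\ u], as [g n] is positive. *)
  move=> _ /in_dual_ex[u ->] u0 a b asup binf x.
  have bP n : exists B : dnlat blat, b n = ap B by have [bd _ _ _] := binf n; exact: in_dual_ex.
  have [B BE] := choice bP.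
  have B0 n : 0 [<=] B n.
    have [ad ag _ _] := asup n; have [_ _ _ h] := binf n.
    rewrite BE in h; apply: (h (ap (0 : dnlat blat))) => //; first exact: in_dual_ap.
    by move=> y y0; apply: le_trans (ag y y0); exact: (g0 n y y0).
  have Bu n : B n [<=] nmeet (g n) u.
    have [_ ba bu _] := binf n; rewrite BE in ba bu.
    apply: nmeet_greatest; apply: ap_leP => y y0.
      apply: le_trans (ba y y0) _; have [_ _ _ h] := asup n.
      apply: (h _ (in_dual_ap (g n))) => // w w0.
      by have := ap_ge0 (g0 n) w0; lra.
    exact: bu.
  have pos (y : blat) : 0 [<=] y -> forall d : R, 0 < d ->
      exists N, forall n, (N <= n)%N -> `|ap (B n) y| <= d.
    move=> y0 d d0; have [N NP] := gu u u0 y y0 d d0; exists N => n Nn.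
    rewrite ger0_norm; last exact: ap_ge0.
    exact: le_trans (ap_le (Bu n) y0) (NP n Nn).
  apply/cvgn0P => d d0; have d2 : 0 < d / 2 by lra.
  have [N1 P1] := pos _ (npos_ge0 (x : blat)) _ d2.
  have [N2 P2] := pos _ (npos_ge0 (- (x : blat))) _ d2.
  exists (maxn N1 N2) => n; rewrite geq_max => /andP[n1 n2]; rewrite BE.
  have -> : ap (B n) x = ap (B n) (npos (x : blat)) - ap (B n) (npos (- (x : blat))).
    by rewrite -apB -nposB.
  apply: le_trans (ler_normB _ _) _; have := P1 n n1; have := P2 n n2; lra.
move=> /(_ _ (in_bidual_of chi))/cvgn0P/(_ (e / 2)); case; first by lra.
move=> N /(_ N (leqnn N)); rewrite of_bidualE => h; exists N.
by apply: le_lt_trans (ler_norm _) _; lra.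
Qed.

(** Monotonicity turns smallness at one index into smallness from there on, and
    [g n /\ u <= g n]. *)
Lemma unbounded_grothendieck_decreasing (chi : dnlat (dnlat blat)) (g : nat -> dnlat blat) :
  (forall n, 0 [<=] g n) -> (forall n, g n.+1 [<=] g n) ->
  (forall x, 0 [<=] x -> forall e : R, 0 < e -> exists n, ap (g n) x <= e) ->
  forall e : R, 0 < e -> exists n, ap chi (g n) < e.
Proof.
move=> g0 gS gx; have gm m n : (m <= n)%N -> g n [<=] g m.
  elim: n => [|n IH]; first by rewrite leqn0 => /eqP ->; exact: nle_refl.
  rewrite leq_eqVlt => /predU1P[->|]; first exact: nle_refl.
  by rewrite ltnS => /IH; exact: nle_trans.
apply: (@unbounded_grothendieck_null g (nrm (g 0%N))) => //.
  by move=> n; apply: nrm_pos_le => //; exact: gm.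
move=> u u0 x x0 e e0; have [N NP] := gx x x0 e e0; exists N => n Nn.
apply: le_trans NP; apply: ap_le => //.
exact: nle_trans (nmeetl _ _) (gm _ _ Nn).
Qed.

(** The meets [v n /\ u] are disjoint, so their partial sums stay below [u]; the series of their
    values at [x] converges and its terms tend to [0]. *)
Lemma unbounded_grothendieck_disjoint (phi : dnlat (dnlat blat)) (v : nat -> dnlat blat) :
  (forall n, 0 [<=] v n) -> (forall n, nrm (v n) <= 1) ->
  (forall m n, (m < n)%N -> disj (v m) (v n)) ->
  forall e : R, 0 < e -> exists n, ap phi (v n) < e.
Proof.
move=> v0 v1 vd; apply: (@unbounded_grothendieck_null v 1) => //.
move=> u u0 x x0 e e0; pose w n := nmeet (v n) u.
have w0 n : 0 [<=] w n by exact: nmeet_ge0.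
pose S K := \sum_(0 <= n < K) w n.
have SS K : S K.+1 = S K + w K by rewrite /S big_nat_recr.
have S0 K : 0 [<=] S K by apply: nsum_ge0.
have Sd K m : (K <= m)%N -> disj (S K) (v m).
  elim: K => [|K IH] Km.
    by rewrite /S big_geq //; apply: nle_anti; [exact: nmeetl|exact: nmeet_ge0 (nle_refl 0) _].
  rewrite SS; apply: disjD => //; first by apply: IH; exact: ltnW.
  by apply: disjW (vd _ _ Km) => //; exact: nmeetl.
have Su K : S K [<=] u.
  elim: K => [|K IH]; first by rewrite /S big_geq.
  rewrite SS; apply: disj_add_le => //; last exact: nmeetr.
  by apply: disjW (Sd _ _ (leqnn K)) => //; exact: nmeetl.
have cs : cvgn (series (fun n => ap (w n) x)).
  apply: nondecreasing_is_cvgn.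
    by apply/nondecreasing_seqP => n; rewrite seriesSr lerDl; exact: ap_ge0.
  exists (ap u x) => _ [K _ <-]; have -> : series (fun n => ap (w n) x) K = ap (S K) x by rewrite /S ap_suml.
  exact: ap_le.
have /cvgn0P/(_ e e0)[N NP] := cvg_series_cvg_0 cs.
by exists N => n Nn; apply: le_trans (ler_norm _) (NP n Nn).
Qed.

(** Hahn-Banach with the norm as upper bound and the ray through [y] as constraint. *)
Lemma norming_functional (y : E) : exists2 f : dnlat blat, nrm f <= 1 & ap f y = `|y|.
Proof.
pose N (x : E) := `|x|; pose K (x : E) t := exists2 a : R, 0 <= a & x = a *: y /\ t = a * `|y|.
have Ns : sublin N.
  by split=> [u v|a v a0]; [exact: ler_normD|rewrite /N normrZ ger0_norm].
have Kc : vcone K.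
  split.
  - by exists 0 => //; rewrite scale0r mul0r.
  - move=> _ _ _ _ [a a0 [-> ->]] [b b0 [-> ->]].
    by exists (a + b); rewrite ?addr_ge0 // scalerDl mulrDl.
  - move=> c _ _ c0 [a a0 [-> ->]].
    by exists (c * a); rewrite ?mulr_ge0 // scalerA mulrA.
have [|f [fl fN fK]] := hahn_banach_sandwich Ns Kc.
  by move=> _ _ [a a0 [-> ->]]; rewrite /N normrZ ger0_norm.
have f1 x : `|f x| <= 1 * `|x|.
  have := fN x; have := fN (- x); rewrite linN // /N normrN ler_norml => ? ?.
  by apply/andP; split; lra.
have fb : @bfun R blat f by split=> //; exists 1.
exists (mkdual fb); first by apply: nrm_dual_le.
apply/eqP; rewrite eq_le; apply/andP; split; first exact: fN.
by apply: fK; exists 1; rewrite ?scale1r ?mul1r.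
Qed.

Lemma unbounded_grothendieck_reflexive : reflexive_space E.
Proof.
apply/reflexive_spaceE => phi.
have h0 n : 0 < (2^-1) ^+ n :> R by rewrite exprn_gt0 // invr_gt0.
have [y yP] := choice (fun n => bidual_approximation unbounded_grothendieck_decreasing
  unbounded_grothendieck_disjoint phi (h0 n)).
have hmono m n : (m <= n)%N -> (2^-1) ^+ n <= (2^-1) ^+ m :> R.
  by move=> mn; apply: ler_wiXn2l => //; lra.
(* The norm of [y m - y n] is attained at a functional in the unit ball, where both points are close
   to [phi]. *)
have yC m n : (m <= n)%N -> `|(y m : E) - y n| <= 2 * (2^-1) ^+ m.
  move=> mn; have [f f1 <-] := norming_functional ((y m : E) - y n).
  have := yP m f f1; have := yP n f f1; have := hmono _ _ mn.
  rewrite (apB f (y m) (y n)) !ler_norml => ? /andP[? ?] /andP[? ?]; lra.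
have small (e : R) : 0 < e -> exists M, forall n, (M <= n)%N -> 2 * (2^-1) ^+ n <= e.
  move=> e0; have [M MP] := half_pow_small 2 e0.
  by exists M => n Mn; rewrite mulrC; exact: MP.
have cy : cvgn (y : nat -> E).
  apply/cauchy_cvgP; apply: cauchy_exP => e e0; have e2 : 0 < e / 2 by lra.
  have [M MP] := small _ e2; exists (y M); exists M => // n /= Mn.
  rewrite -ball_normE /=; apply: le_lt_trans (yC _ _ Mn) _.
  by apply: le_lt_trans (MP M (leqnn M)) _; lra.
pose l := limn (y : nat -> E).
have unit_ball f : nrm f <= 1 -> ap phi f = ap f (l : blat).
  move=> f1; apply/eqP; rewrite -subr_eq0 -normr_le0; apply/ler_addgt0Pr => e e0.
  rewrite add0r; have e2 : 0 < e / 2 by lra.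
  have /cvgrPdist_le/(_ _ e2)[N1 _ P1] := cy.
  have [N2 P2] := small _ e2.
  pose n := maxn N1 N2.
  have a1 : `|l - y n| <= e / 2 by apply: P1; rewrite /= /n leq_maxl.
  have a2 := P2 n (leq_maxr _ _).
  have a3 := yP n f f1.
  have a4 : `|ap f ((l : blat) - y n)| <= `|l - y n|.
    apply: le_trans (apb _ _) _; rewrite -[leRHS]mul1r.
    by apply: ler_wpM2r => //; exact: nrm_ge0.
  have a5 := h0 n.
  have -> : ap phi f - ap f (l : blat) =
      (ap phi f - ap f (y n)) - ap f ((l : blat) - y n) by rewrite apB; ring.
  apply: le_trans (ler_normB _ _) _; move: a1 a2 a3 a4 a5; lra.
(* Equality on the unit ball extends by scaling; the added [1] keeps [c] positive when
   [nrm f = 0]. *)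
exists l => f; pose c := nrm f + 1.
have c0 : 0 < c by rewrite /c ltr_wpDl // nrm_ge0.
have ci : 0 <= c^-1 by rewrite invr_ge0 ltW.
have := unit_ball (c^-1 *: f); rewrite nrmZ ger0_norm // mulrC ler_pdivrMr // mul1r.
rewrite apZ apZl => /(_ ltac:(by rewrite /c lerDl)) /(congr1 ( *%R c)).
by rewrite !mulrA mulfV ?lt0r_neq0 // !mul1r.
Qed.

End Converse.

End BanachLattice.

Theorem theorem2p4 (R : realType) (E : completeNormedModType R)
  (L : banach_lattice E) :
  reflexive_space E <-> unbounded_grothendieck L.
Proof.
split; first exact: reflexive_unbounded_grothendieck.
exact: unbounded_grothendieck_reflexive.
Qed.
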